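(* Let $G$ be a connected regular graph (simple, locally finite) with an even or infinite number of vertices. If $G$ has non-negative Bakry-Émery curvature, then $G$ has a perfect matching.
   Context: All graphs are simple and locally finite (every vertex has finite degree), possibly infinite. Let $G=(V,E)$ be such a graph. A matching of $G$ is a set of mutually disjoint edges; it is perfect if every vertex of $G$ is incident with an edge of the matching. Bakry-Émery curvature: for $f:V\to\mathbb{R}$ and $x\in V$ put $\Delta f(x):=\sum_{y\sim x}(f(y)-f(x))$, where $y\sim x$ means that $y$ is adjacent to $x$. For $f,g:V\to\mathbb{R}$ put $$\Gamma(f,g)(x):=\tfrac12\left(\Delta(fg)-(\Delta f)g-f(\Delta g)\right)(x),$$ $$\Gamma_2(f,g)(x):=\tfrac12\left(\Delta\Gamma(f,g)-\Gamma(\Delta f,g)-\Gamma(f,\Delta g)\right)(x),$$ and $\Gamma(f):=\Gamma(f,f)$, $\Gamma_2(f):=\Gamma_2(f,f)$. For $K\in\mathbb{R}$, $G$ satisfies $CD(\infty,K)$ at $x$ if $\Gamma_2(f)(x)\ge K\,\Gamma(f)(x)$ for every $f:V\to\mathbb{R}$. The Bakry-Émery curvature of $G$ at $x$ is $K_{BE}(G,x):=\sup\{K: G\text{ satisfies }CD(\infty,K)\text{ at }x\}$, and the Bakry-Émery curvature of $G$ is $K_{BE}(G):=\inf_{x\in V}K_{BE}(G,x)$. Non-negative Bakry-Émery curvature means $K_{BE}(G)\ge 0$, equivalently $G$ satisfies $CD(\infty,0)$ at every vertex. *)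

(* Defs.v *)
From HB Require Import structures.
From mathcomp Require Import all_boot all_order all_algebra.
From mathcomp Require Import all_classical all_reals ereal.

Set Implicit Arguments.
Unset Strict Implicit.
Unset Printing Implicit Defensive.

Import Order.TTheory GRing.Theory Num.Theory.

Local Open Scope classical_set_scope.
Local Open Scope ring_scope.

Definition neighbors (V : Type) (e : rel V) (x : V) : set V := [set y | e x y].

Record lfgraph (V : choiceType) := LFGraph {
  adj :> rel V;
  adj_sym : symmetric adj;
  adj_irrefl : irreflexive adj;
  adj_locally_finite : forall x, finite_set (neighbors adj x)
}.

Section Graphs.
Variables (V : choiceType) (G : lfgraph V).

Definition connected_graph : Prop :=
  forall x y : V, exists2 p : seq V, path G x p & last x p = y.

Definition regular_graph : Prop :=
  exists d : nat, forall x : V, (neighbors G x #= `I_d)%card.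

Definition is_edge (s : set V) : Prop :=
  exists x y : V, G x y /\ s = [set x; y].

Definition matching (M : set (set V)) : Prop :=
  (forall s, M s -> is_edge s) /\ trivIset M id.

Definition perfect_matching (M : set (set V)) : Prop :=
  matching M /\ forall v : V, exists2 s, M s & s v.

End Graphs.

Definition even_or_infinite (V : Type) : Prop :=
  infinite_set [set: V] \/
  exists2 n : nat, ([set: V] #= `I_n)%card & ~~ odd n.

Section BakryEmery.
Variables (R : realType) (V : choiceType) (G : lfgraph V).
Implicit Types (f g : V -> R) (x : V) (K : R).

Definition laplacian f : V -> R :=
  fun x => \sum_(y \in neighbors G x) (f y - f x).

Definition Gamma f g : V -> R := fun x =>
  2^-1 * (laplacian (f \* g) x - laplacian f x * g x - f x * laplacian g x).

Definition Gamma2 f g : V -> R := fun x =>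
  2^-1 * (laplacian (Gamma f g) x
          - Gamma (laplacian f) g x - Gamma f (laplacian g) x).

Definition CD_infty K x : Prop :=
  forall f, K * Gamma f f x <= Gamma2 f f x.

(* The values live in \bar R: every real K is admissible at an isolated vertex,
   where the supremum is +oo. *)
Definition BE_curvature_at x : \bar R :=
  ereal_sup [set K%:E | K in [set K : R | CD_infty K x]].

Definition BE_curvature : \bar R :=
  ereal_inf [set BE_curvature_at x | x in [set: V]].

End BakryEmery.

Arguments BE_curvature R {V} G.
Arguments BE_curvature_at R {V} G x.

(* Main.v *)
Require Import Defs.
From HB Require Import structures.
From mathcomp Require Import all_boot all_order all_algebra.
From mathcomp Require Import all_classical all_reals ereal.
From mathcomp Require Import finmap zify ring lra.

Set Implicit Arguments.
Unset Strict Implicit.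
Unset Printing Implicit Defensive.

(** Let the graph be [d]-regular.  The heart of the matter is that every cut
    then has at least [d - 1] edges ([edge_connectivity]).

    For [f] vanishing at [x], four times [Gamma2 f f x] is the sum of
    [(f z - 2 f y)^2] over the walks [x ~ y ~ z], minus [2 d] times the sum of
    [(f y)^2] over the neighbours [y] of [x], plus twice the square of the sum
    of the [f y] ([CD0_regular]).  Non-negative curvature says that this is
    non-negative.  If [f] takes one value on the neighbours of [x] on either
    side of a cut, and about twice that value at distance two, then, besides the
    walks that return to [x], mostly edges of the cut and edges between
    neighbours of [x] contribute to the first sum, so that a cut with few edges
    makes the form negative.

    Precisely, consider a cut with fewer than [d - 1] edges and suppose that
    there is no smaller one.  No vertex has more than [d / 2] neighbours across
    the cut, for moving it to the other side would give a smaller cut.  Let [x]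
    be a vertex with as many neighbours across the cut as possible, [n] say.
    Two-valued test functions at [x] give a polynomial of degree two in a free
    parameter, and its discriminant an inequality between natural numbers
    ([two_value_nat]) that fails unless [n = 2] and [d] is 6 or 7
    ([cut_arithmetic]).  In these cases the vertices with two neighbours across
    the cut would span a cycle of length four in the cut, and a test function
    with three values excludes it ([three_value_ineq], [no_exception]).

    A finite set of odd size whose complement is not empty is joined to the
    complement by a number of edges of the parity of [d], hence by at least [d]
    edges ([odd_cut]).  This is what Tutte's theorem needs: if the removal of a
    finite set [S] leaves [k] odd components, they send at least [d k] edges to
    [S], which receives at most [d] times its size.  The theorem is applied to
    finite pieces of the graph and yields matchings covering any given finite
    set of vertices ([finite_matching]); local finiteness turns these into a
    perfect matching ([matching_compactness]). *)

(** * Hall's theorem *)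

Section Hall.
Import mathcomp.boot.fintype mathcomp.boot.finset.

(** The elements related by [r] to some element of [B]. *)
Definition rel_image (I J : finType) (r : I -> J -> bool) (B : {set I}) :
  {set J} := [set j | [exists i in B, r i j]].

Lemma hall (I J : finType) (r : I -> J -> bool) (A : {set I}) :
  (forall B : {set I}, B \subset A -> #|B| <= #|rel_image r B|) ->
  A != set0 ->
  exists f : I -> J, {in A &, injective f} /\ {in A, forall i, r i (f i)}.
Proof.
move: {2}#|A| (leqnn #|A|) => k; elim: k r A => [|k IH] r A.
  by rewrite leqn0 cards_eq0 => ->.
move=> leAk hallA /set0Pn[i0 i0A].
(* Either every proper nonempty subset has a spare image, and [i0] may be
   matched arbitrarily, or a tight subset splits the problem in two. *)
case: (boolP [exists B : {set I}, [&& B \proper A, B != set0 &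
    #|rel_image r B| <= #|B|]]) => [/existsP[B /and3P[BA B0 tight]]|noB].
  have ltBA := proper_card BA; have sBA := proper_sub BA.
  have [|C CB|//|f [injf rf]] := IH r B.
  - by rewrite -ltnS; apply: leq_trans leAk.
  - by apply: hallA; apply: subset_trans sBA.
  pose r' i j := r i j && (j \notin rel_image r B).
  have AB0 : A :\: B != set0.
    by rewrite setD_eq0; move: BA; rewrite properE => /andP[].
  have [||//|g [injg rg]] := IH r' (A :\: B).
  - have := cardsID B A; rewrite (setIidPr sBA).
    by move: B0; rewrite -card_gt0; lia.
  - move=> C CAB.
    have CA : C \subset A by apply: subset_trans CAB (subsetDl _ _).
    have dBC : B :&: C = set0.
      apply/eqP; rewrite setI_eq0 disjoint_sym.
      by move: CAB; rewrite subsetD => /andP[].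
    have := hallA (B :|: C); rewrite subUset sBA CA => /(_ isT).
    have := cardsUI B C; rewrite dBC cards0 addn0 => ->.
    have -> : rel_image r (B :|: C) = rel_image r B :|: rel_image r' C.
      apply/setP=> j; rewrite !inE; apply/existsP/orP.
        case=> i /andP[]; rewrite inE => /orP[iB|iC] rij.
          by left; apply/existsP; exists i; rewrite iB.
        have [jB|jB] := boolP (j \in rel_image r B).
          by left; rewrite inE in jB.
        by right; apply/existsP; exists i; rewrite iC /r' rij.
      case=> /existsP[i /andP[iB rij]]; exists i; rewrite inE iB ?orbT //.
      by case/andP: rij.
    have := cardsUI (rel_image r B) (rel_image r' C); lia.
  exists (fun i => if i \in B then f i else g i); split=> [i j iA jA|i iA].
    have imf : forall l, l \in B -> f l \in rel_image r B.
      by move=> l lB; rewrite inE; apply/existsP; exists l; rewrite lB rf.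
    have img : forall l, l \in A -> l \notin B -> g l \notin rel_image r B.
      by move=> l lA lB; have := rg l; rewrite inE lA lB => /(_ isT)/andP[].
    case: ifP => iB; case: ifP => jB; first exact: injf.
    - by move=> e; have := img j jA; rewrite jB -e imf // => /(_ isT).
    - by move=> e; have := img i iA; rewrite iB e imf // => /(_ isT).
    - by apply: injg; rewrite inE ?iA ?jA ?iB ?jB.
  case: ifP => iB; first exact: rf.
  by have := rg i; rewrite inE iB iA => /(_ isT)/andP[].
have : 0 < #|rel_image r [set i0]|.
  by apply: leq_trans (hallA [set i0] _); rewrite ?cards1 ?sub1set.
case/card_gt0P => j0; rewrite inE => /existsP[i1 /andP[]]; rewrite inE.
move/eqP=> -> {i1} rij0.
have [/eqP A0|A0] := boolP (A :\ i0 == set0).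
  exists (fun=> j0); split=> [i j|i] iA.
    have in0 l : l \in A -> l = i0.
      move=> lA; apply/eqP; apply: contraT => li0.
      by have := in_set0 l; rewrite -A0 !inE li0 lA.
    by move/in0=> -> _; rewrite (in0 i).
  apply: contraTT rij0 => nr; have := in_set0 i; rewrite -A0 !inE iA andbT.
  by move/negbFE/eqP => <-.
pose r' i j := r i j && (j != j0).
have cA := cardsD1 i0 A; rewrite i0A in cA.
have [||//|g [injg rg]] := IH r' (A :\ i0); first by lia.
  move=> C CA.
  have [->|C0] := eqVneq C set0; first by rewrite cards0.
  have CpA : C \proper A.
    by apply: sub_proper_trans CA _; rewrite properD1.
  have ltC : #|C| < #|rel_image r C|.
    rewrite ltnNge; apply: contra noB => tight.
    by apply/existsP; exists C; rewrite CpA C0.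
  suff : #|rel_image r C| <= #|rel_image r' C| + 1 by lia.
  rewrite -(cards1 j0); apply: leq_trans (subset_leq_card _) (leq_card_setU _ _).
  apply/subsetP=> j; rewrite !inE => /existsP[i /andP[iC rij]].
  have [->|jj0] := eqVneq j j0; first by rewrite orbT.
  by rewrite orbF; apply/existsP; exists i; rewrite iC /r' rij.
exists (fun i => if i == i0 then j0 else g i).
have gj0 i : i \in A -> i != i0 -> r i (g i) /\ g i <> j0.
  by move=> iA ii0; have := rg i; rewrite !inE iA ii0 => /(_ isT)/andP[? /eqP].
split=> [i j iA jA|i iA].
  case: (eqVneq i i0) => [->|ii0]; case: (eqVneq j i0) => [->|ji0] //.
  - by move=> e; have [_ []] := gj0 j jA ji0.
  - by move=> e; have [_ []] := gj0 i iA ii0.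
  - by apply: injg; rewrite !inE ?ii0 ?ji0.
by case: (eqVneq i i0) => [->//|ii0]; have [] := gj0 i iA ii0.
Qed.

End Hall.

(** * Tutte's theorem *)

Section Tutte.
Import mathcomp.boot.fintype mathcomp.boot.finset.
Variables (T : finType) (e : rel T).
Hypothesis e_sym : symmetric e.
Implicit Types W S C D : {set T}.

(** [C] is an odd set that is a union of connected components of the graph
    induced on [W :\: S].  Counting disjoint sets of this kind amounts to
    counting the odd components, and dispenses with connectedness. *)
Definition odd_part W S C :=
  [&& odd #|C|, C \subset W :\: S &
      [forall u in C, forall v in W, e u v ==> (v \in C :|: S)]].

Definition odd_family W S (P : {set {set T}}) :=
  trivIset P && [forall C in P, odd_part W S C].

(** Tutte's condition for the graph induced on [W]. *)
Definition tutte_condition W :=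
  forall S (P : {set {set T}}), S \subset W -> odd_family W S P -> #|P| <= #|S|.

Lemma disjointsU (A B D : {set T}) :
  [disjoint D & A :|: B] = [disjoint D & A] && [disjoint D & B].
Proof. by rewrite -!setI_eq0 setIUr setU_eq0. Qed.

Lemma odd_partP W S C : reflect
  [/\ odd #|C|, C \subset W, [disjoint C & S] &
      forall u v, u \in C -> v \in W -> e u v -> v \notin S -> v \in C]
  (odd_part W S C).
Proof.
apply: (iffP and3P) => [[oC]|[oC CW CS clC]].
  rewrite subsetD => /andP[CW CS] /forall_inP clC; split=> // u v uC vW uv vS.
  have /forall_inP/(_ v vW)/implyP/(_ uv) := clC u uC.
  by rewrite inE (negbTE vS) orbF.
split; rewrite ?subsetD ?CW //.
apply/forall_inP => u uC; apply/forall_inP => v vW; apply/implyP => uv.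
by rewrite inE orbC; case: (boolP (v \in S)) => //= vS; apply: (clC u).
Qed.

Lemma odd_familyP W S (P : {set {set T}}) : reflect
  [/\ forall C D, C \in P -> D \in P -> C != D -> [disjoint C & D] &
      forall C, C \in P -> odd_part W S C]
  (odd_family W S P).
Proof.
apply: (iffP andP) => -[tP oP]; split.
- by move=> C D CP DP; apply: (trivIsetP tP).
- by move=> C CP; apply: (forall_inP oP).
- by apply/trivIsetP.
- by apply/forall_inP.
Qed.

Lemma odd_part_neq0 W S C : odd_part W S C -> C != set0.
Proof. by case/and3P => oC _ _; apply: contraTneq oC => ->; rewrite cards0. Qed.

Lemma odd_familyU W S (P : {set {set T}}) R : odd_family W S P ->
    odd_part W S R -> [disjoint cover P & R] ->
  odd_family W S (R |: P) /\ #|R |: P| = #|P|.+1.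
Proof.
move=> /odd_familyP[dP oP] oR dR.
have dRC C : C \in P -> [disjoint C & R].
  by move=> CP; apply: disjointWl dR; apply: bigcup_sup.
split; last first.
  rewrite cardsU1; case: (boolP (R \in P)) => // /dRC.
  by rewrite -setI_eq0 setIid (negbTE (odd_part_neq0 oR)).
apply/odd_familyP; split=> [C D|C]; rewrite !inE; last by case/predU1P => [->|/oP].
case/predU1P => [->|CP] /predU1P[->|DP]; last exact: dP; first by rewrite eqxx.
- by rewrite disjoint_sym => _; apply: dRC.
- by move=> _; apply: dRC.
Qed.

Section Rest.
Variables (W S : {set T}) (P : {set {set T}}).
Hypotheses (SW : S \subset W) (famP : odd_family W S P).

(** What an odd family leaves of [W :\: S]: the union of the even components,
    when the family consists of all the odd ones. *)
Let R := W :\: S :\: cover P.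

Lemma rest_closed u v : u \in R -> v \in W -> e u v -> v \notin S -> v \in R.
Proof.
have /odd_familyP[dP oP] := famP.
rewrite !inE => /and3P[uP uS uW] -> uv ->; rewrite !andbT.
apply: contra uP => /bigcupP[C CP vC]; apply/bigcupP; exists C => //.
have /odd_partP[_ _ _ clC] := oP C CP.
by apply: (clC v u) => //; rewrite e_sym.
Qed.

Lemma rest_disjoint : [disjoint cover P & R].
Proof.
rewrite -setI_eq0 -subset0; apply/subsetP=> v.
by rewrite !inE; case: (v \in cover P).
Qed.

Lemma odd_rest : odd #|R| = odd (#|W| + #|S| + #|P|).
Proof.
have /odd_familyP[dP oP] := famP.
have covW : cover P \subset W :\: S.
  by apply/bigcupsP => C /oP/and3P[].
have := cardsID S W; have := cardsID (cover P) (W :\: S).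
rewrite (setIidPr SW) (setIidPr covW) -/R.
have /andP[/eqP <- _] := famP.
have -> : \sum_(C in P) #|C| = #|P| + (\sum_(C in P) #|C|./2).*2.
  rewrite -muln2 big_distrl -sum1_card -big_split /=; apply: eq_bigr => C CP.
  by have /and3P[oC _ _] := oP C CP; lia.
lia.
Qed.

Lemma odd_family_complete : odd (#|W| + #|S| + #|P|) ->
  odd_family W S (R |: P) /\ #|R |: P| = #|P|.+1.
Proof.
rewrite -odd_rest => oR; apply: odd_familyU rest_disjoint => //.
apply/odd_partP; split=> //; last exact: rest_closed.
  by rewrite /R setDDl subsetDl.
rewrite -setI_eq0 -subset0; apply/subsetP=> v; rewrite !inE.
by case: (v \in S); rewrite ?andbF.
Qed.

End Rest.

(** A tight barrier: a set [S] leaving exactly [#|S|] odd components, and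
    largest among those. *)
Lemma max_barrier W : exists S (P : {set {set T}}),
  [/\ S \subset W, odd_family W S P, #|P| = #|S| &
      forall S' (P' : {set {set T}}), S' \subset W -> odd_family W S' P' ->
        #|P'| = #|S'| -> #|S'| <= #|S|].
Proof.
pose good (p : {set T} * {set {set T}}) :=
  [&& p.1 \subset W, odd_family W p.1 p.2 & #|p.2| == #|p.1|].
have good0 : good (set0, set0).
  rewrite /good /= sub0set !cards0 eqxx andbT.
  by apply/odd_familyP; split=> [C D|C]; rewrite inE.
case: (arg_maxnP (fun p : {set T} * {set {set T}} => #|p.1|) good0).
case=> S P /and3P[/= SW fP /eqP cP] mx.
exists S, P; split=> // S' P' S'W fP' cP'.
by apply: (mx (S', P')); rewrite /good /= S'W fP' cP' eqxx.
Qed.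

Lemma odd_part_restrict W S C c D (T0 : {set T}) : odd_part W S C -> c \in C ->
    T0 \subset C :\ c -> odd_part (C :\ c) T0 D ->
  odd_part W (S :|: T0 :|: [set c]) D.
Proof.
move=> /odd_partP[_ CW CS clC] cC TC /odd_partP[oD DC DT clD].
have DCc u : u \in D -> (u != c) && (u \in C) by move/(subsetP DC); rewrite !inE.
apply/odd_partP; split=> //.
- by apply: subset_trans DC (subset_trans (subsetDl _ _) CW).
- rewrite !disjointsU DT andbT; apply/andP; split.
    by apply: disjointWl CS; apply/subsetP => u /DCc/andP[].
  by rewrite disjoint_sym disjoints1; apply/negP => /DCc; rewrite eqxx.
- move=> u v uD vW uv; rewrite !inE !negb_or => /andP[/andP[vS vT] vc].
  have /andP[_ uC] := DCc u uD.
  by apply: (clD u) => //; rewrite !inE vc; apply: (clC u).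
Qed.

(** The theorem, by induction on [W], following Anderson: for a largest tight
    barrier [S] there is no even component, each odd component minus any of its
    vertices inherits Tutte's condition, and Hall's theorem matches [S] with
    the odd components. *)
Theorem tutte W : tutte_condition W ->
  exists m : T -> T,
    forall u, u \in W -> [/\ m u \in W, m (m u) = u & e u (m u)].
Proof.
move: {2}#|W| (leqnn #|W|) => k; elim: k W => [|k IH] W leWk condW.
  move: leWk; rewrite leqn0 cards_eq0 => /eqP->.
  by exists id => u; rewrite inE.
have [S [P [SW fP cPS maxS]]] := max_barrier W.
have /odd_familyP[dP oP] := fP.
have evW : ~~ odd #|W|.
  apply/negP => oW; have /(condW set0) : odd_family W set0 [set W].
    apply/odd_familyP; split=> [C D|C]; rewrite !inE.
      by move=> /eqP-> /eqP->; rewrite eqxx.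
    move/eqP->; apply/odd_partP; split=> //.
    by rewrite -setI_eq0 setI0.
  by rewrite cards1 cards0 sub0set => /(_ isT).
have evR : ~~ odd #|W :\: S :\: cover P|.
  by rewrite (odd_rest SW fP); move: evW; lia.
(* An even component would enlarge the barrier by any of its vertices. *)
have R0 : W :\: S :\: cover P = set0.
  apply/eqP; apply: contraT => /set0Pn[v vR].
  set R := W :\: S :\: cover P in evR vR *.
  have RW : R \subset W by rewrite /R setDDl subsetDl.
  have RS : [disjoint R & S].
    rewrite -setI_eq0 -subset0; apply/subsetP=> u; rewrite !inE.
    by case: (u \in S); rewrite ?andbF.
  have vS : v \notin S by move/disjointFr: RS => ->.
  have fP' : odd_family W (v |: S) P.
    apply/odd_familyP; split=> // C CP.
    have /odd_partP[oC CW CS clC] := oP C CP.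
    apply/odd_partP; split=> //.
      rewrite disjointsU CS andbT disjoint_sym disjoints1.
      have := disjointFl (rest_disjoint W S P) vR.
      by apply: contraFN => vC; apply/bigcupP; exists C.
    by move=> u w uC wW uw; rewrite !inE negb_or => /andP[_]; apply: (clC u).
  have [||f2 c2] := @odd_familyU W (v |: S) P (R :\ v) fP'.
  - apply/odd_partP; split.
    + by have := cardsD1 v R; rewrite vR; move: evR; lia.
    + by apply: subset_trans RW; apply: subsetDl.
    + rewrite -setI_eq0 -subset0; apply/subsetP=> u; rewrite !inE.
      by case: (u == v); case: (u \in S); rewrite ?andbF.
    + move=> u w /setD1P[_ uR] wW uw; rewrite inE negb_or => /andP[wv wS].
      by apply/setD1P; split; [move: wv; rewrite inE|apply: (rest_closed fP uR)].
  - by apply: disjointWr (rest_disjoint W S P); apply: subsetDl.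
  have vW : v \in W by apply: (subsetP RW).
  have := maxS (v |: S) (R :\ v |: P).
  rewrite c2 cardsU1 vS cPS subUset sub1set vW SW.
  by move=> /(_ isT f2 erefl); rewrite ltnn.
have sCW C : C \in P -> C \subset W by move/oP/odd_partP => [].
have sCS C : C \in P -> [disjoint C & S] by move/oP/odd_partP => [].
have subcond C c : C \in P -> c \in C -> tutte_condition (C :\ c).
  move=> CP cC S' P' S'C fP'; rewrite leqNgt; apply/negP => bad.
  have [P2 [fP2 cP2]] : exists P2, odd_family (C :\ c) S' P2 /\ #|S'|.+1 < #|P2|.
    case: (ltnP #|S'|.+1 #|P'|) => [lt2|le2]; first by exists P'.
    have [|f2 c2] := odd_family_complete S'C fP'; last first.
      by eexists; split; [exact: f2|rewrite c2; lia].
    have /odd_partP[oC _ _ _] := oP C CP.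
    by have := cardsD1 c C; rewrite cC; lia.
  have /odd_familyP[dP2 oP2] := fP2.
  pose S2 := S :|: S' :|: [set c]; pose Q := P :\ C :|: P2.
  have sDC D : D \in P2 -> D \subset C.
    by move/oP2/odd_partP => [_ DC _ _]; apply: subset_trans DC (subsetDl _ _).
  have dQ D E : D \in P :\ C -> E \in P2 -> [disjoint D & E].
    rewrite !inE => /andP[DC DP] EP.
    by apply: disjointWr (sDC E EP) _; apply: dP.
  have fQ : odd_family W S2 Q.
    apply/odd_familyP; split=> [D E|D].
      rewrite [D \in _]inE [E \in _]inE => /orP[]DP /orP[]EP; last exact: dP2.
      - by move: DP EP; rewrite !inE => /andP[_ DP] /andP[_ EP]; apply: dP.
      - by move=> _; apply: dQ.
      - by move=> _; rewrite disjoint_sym; apply: dQ.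
    rewrite [D \in _]inE => /orP[]DP; last first.
      by apply: odd_part_restrict (oP C CP) cC S'C (oP2 D DP).
    move: DP; rewrite !inE => /andP[DC DP].
    have /odd_partP[oD DW DS clD] := oP D DP.
    have dCD : [disjoint D & C] by apply: dP.
    apply/odd_partP; split=> //.
      rewrite !disjointsU DS /=; apply/andP; split; apply: disjointWr dCD.
        by apply: subset_trans S'C (subsetDl _ _).
      by rewrite sub1set.
    move=> u v uD vW uv; rewrite !inE !negb_or => /andP[/andP[vS _] _].
    exact: (clD u).
  have cQ : #|Q| = #|P|.-1 + #|P2|.
    have := cardsUI (P :\ C) P2; rewrite -/Q.
    have -> : (P :\ C) :&: P2 = set0.
      apply/eqP; rewrite -subset0; apply/subsetP => D.
      rewrite [D \in _]inE => /andP[DP DP2].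
      have := dQ D D DP DP2; rewrite -setI_eq0 setIid.
      by rewrite (negbTE (odd_part_neq0 (oP2 D DP2))).
    by rewrite cards0 addn0 => ->; rewrite (cardsD1 C P) CP.
  have S2W : S2 \subset W.
    rewrite !subUset SW sub1set (subsetP (sCW C CP) c cC) andbT /=.
    by apply: subset_trans S'C _; apply: subset_trans (subsetDl _ _) (sCW C CP).
  have cS2 : #|S2| = (#|S| + #|S'|).+1.
    have cn : c \notin S :|: S'.
      rewrite inE negb_or (disjointFr (sCS C CP) cC) /=.
      by apply: contraTN S'C => cS'; apply/subsetPn; exists c; rewrite ?inE ?eqxx.
    rewrite /S2 setUC cardsU1 cn; have := cardsUI S S'.
    have -> : S :&: S' = set0.
      apply/eqP; rewrite setI_eq0 disjoint_sym.
      apply: disjointWl (sCS C CP); exact: subset_trans S'C (subsetDl _ _).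
    by rewrite cards0 addn0 add1n => ->.
  have P_gt0 : 0 < #|P| by rewrite card_gt0; apply/set0Pn; exists C.
  move: (condW S2 Q S2W fQ) (maxS S2 Q S2W fQ) P_gt0 cP2.
  by rewrite cQ cS2 cPS; clear; lia.
have [P0|P0] := eqVneq P set0.
  exists id => u uW; have := in_set0 u; rewrite -R0 !inE uW andbT /cover P0 big_set0 inE.
  by move: cPS; rewrite P0 cards0 => /esym/eqP; rewrite cards_eq0 => /eqP->; rewrite inE.
pose adjS C s := (s \in S) && [exists c in C, e c s].
have [|//|f [injf adjf]] := @hall _ _ adjS P.
  move=> B BP; apply: condW.
    by apply: subset_trans SW; apply/subsetP=> s; rewrite inE => /existsP[C /and3P[]].
  apply/odd_familyP; split=> [C D CB DB|C CB].
    by apply: dP; apply: (subsetP BP).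
  have CP := subsetP BP C CB; have /odd_partP[oC CW CS clC] := oP C CP.
  apply/odd_partP; split=> //.
    apply: disjointWr CS.
    by apply/subsetP=> s; rewrite inE => /existsP[D /and3P[]].
  move=> u v uC vW uv vB; apply: (clC u) => //; apply: contra vB => vS.
  rewrite inE; apply/existsP; exists C; rewrite CB /adjS vS.
  by apply/existsP; exists u; rewrite uC.
pose cc C := odflt (f C) [pick c in C | e c (f C)].
have fS C : C \in P -> f C \in S by case/adjf/andP.
have [ccC cce] : {in P, forall C, cc C \in C} /\ {in P, forall C, e (cc C) (f C)}.
  split=> C CP; have /andP[_ /exists_inP[c0 cC0 ec0]] := adjf C CP;
    rewrite /cc; case: pickP => [c /andP[] //|/(_ c0)]; by rewrite cC0 ec0.
have fPS : f @: P = S.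
  apply/eqP; rewrite eqEcard card_in_imset // cPS leqnn andbT.
  by apply/subsetP => _ /imsetP[C CP ->]; apply: fS.
pose g s := odflt set0 [pick C in P | f C == s].
have gP s : s \in S -> g s \in P /\ f (g s) = s.
  rewrite -fPS => /imsetP[C CP ->]; rewrite /g; case: pickP => [D /andP[DP /eqP]//|].
  by move/(_ C); rewrite CP eqxx.
have gf C : C \in P -> g (f C) = C.
  by move=> CP; have [gfP e1] := gP _ (fS C CP); apply: injf.
have /boolp.choice[mC mCP] : forall C, exists m : T -> T, C \in P ->
    forall u, u \in C :\ cc C ->
      [/\ m u \in C :\ cc C, m (m u) = u & e u (m u)].
  move=> C; have [CP|_] := boolP (C \in P); last by exists id.
  have [|m mP] := IH (C :\ cc C) _ (subcond C (cc C) CP (ccC C CP)).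
    have := subset_leq_card (sCW C CP); have := cardsD1 (cc C) C.
    by rewrite ccC //; lia.
  by exists m.
have triv : trivIset P by case/andP: fP.
pose b := pblock P.
have bE C u : C \in P -> u \in C -> b u = C by move=> CP uC; apply: def_pblock.
have bP u : u \in W -> u \notin S -> b u \in P /\ u \in b u.
  move=> uW uS; have uc : u \in cover P.
    apply: contraT => uc; have : u \in W :\: S :\: cover P by rewrite !inE uc uS.
    by rewrite R0 inE.
  by rewrite pblock_mem // mem_pblock.
have nS C u : C \in P -> u \in C -> u \notin S.
  by move=> CP uC; rewrite (disjointFr (sCS C CP) uC).
exists (fun u => if u \in S then cc (g u) else
  if u == cc (b u) then f (b u) else mC (b u) u) => u uW.
case: (boolP (u \in S)) => uS.
  have [gSP fg] := gP u uS; have cg := ccC _ gSP.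
  rewrite (negbTE (nS _ _ gSP cg)) (bE _ _ gSP cg) eqxx fg.
  split=> //; first by apply: (subsetP (sCW _ gSP)).
  by rewrite e_sym; have := cce _ gSP; rewrite fg.
have [bu ub] := bP u uW uS.
case: (eqVneq u (cc (b u))) => [ucc|ucc].
  rewrite fS // gf // -ucc; split=> //; first by apply: (subsetP SW); apply: fS.
  by rewrite {1}ucc; apply: cce.
have uD : u \in b u :\ cc (b u) by rewrite !inE ucc.
have [mu mmu emu] := mCP _ bu u uD.
move: mu; rewrite !inE => /andP[muc mub].
rewrite (negbTE (nS _ _ bu mub)) (bE _ _ bu mub) (negbTE muc).
by split=> //; apply: (subsetP (sCW _ bu)).
Qed.

End Tutte.

(** * Neighbour lists *)

Section Neighbours.
Variables (V : choiceType) (G : lfgraph V).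

(** The list of the neighbours of a vertex, without repetition. *)
Definition nb (x : V) : seq V := fset_set (neighbors G x).

Lemma mem_nb x y : (y \in nb x) = G x y.
Proof.
rewrite /nb in_fset_set ?mem_setE //; exact: adj_locally_finite.
Qed.

Lemma nb_uniq x : uniq (nb x).
Proof. exact: fset_uniq. Qed.

Lemma regular_size_nb : regular_graph G -> exists d, forall x, size (nb x) = d.
Proof. by case=> d dP; exists d => x; rewrite -(card_fset_set (dP x)). Qed.

End Neighbours.

(** * From finite to infinite matchings *)

Section Compactness.
Local Open Scope classical_set_scope.
Variables (V : choiceType) (G : lfgraph V).

(** The sets of finite lists that contain all the lists extending some given
    finite list. *)
Definition large_lists : set_system (seq V) :=
  [set A | exists F0 : seq V, forall F : seq V, {subset F0 <= F} -> A F].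

Lemma large_lists_filter : ProperFilter large_lists.
Proof.
apply: Build_ProperFilter_ex; first by move=> A [F0 F0A]; exists F0; apply: F0A.
split.
- by exists [::].
- move=> A B [FA AP] [FB BP]; exists (FA ++ FB) => F sF; split.
    by apply: AP => v vA; apply: sF; rewrite mem_cat vA.
  by apply: BP => v vB; apply: sF; rewrite mem_cat vB orbT.
- by move=> A B AB [F0 F0A]; exists F0 => F /F0A/AB.
Qed.

Lemma ultra_finite_choice (T I : eqType) (U : set_system I) (f : I -> T)
    (s : seq T) : UltraFilter U -> U [set i | f i \in s] ->
  exists y, U [set i | f i = y].
Proof.
move=> uU; elim: s => [|y s IH] Us.
  by case: (@filter_not_empty _ U _); apply: filterS Us => i.
have [Uy|Uy] := in_ultra_setVsetC [set i | f i = y] uU; first by exists y.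
apply: IH; apply: filterS (filterI Us Uy) => i /= [].
by rewrite inE => /predU1P[].
Qed.

(** Matchings are encoded by the map [m] exchanging the ends of each edge.  By
    local finiteness a value of the partner of [v] is taken for almost all
    finite lists, in the sense of an ultrafilter; these values fit together. *)
Lemma matching_compactness :
    (forall F : seq V, exists m : V -> V,
       forall v, v \in F -> G v (m v) /\ m (m v) = v) ->
  exists m : V -> V, forall v, G v (m v) /\ m (m v) = v.
Proof.
move=> /boolp.choice[m mP].
have [U [uU sU]] := ultraFilterLemma large_lists_filter.
have Uv v : U [set F : seq V | G v (m F v) /\ m F (m F v) = v].
  apply: sU; exists [:: v] => F sF; apply: mP; apply: sF; exact: mem_head.
have /boolp.choice[M MP] : forall v, exists y, U [set F : seq V | m F v = y].
  move=> v; apply: (ultra_finite_choice (s := nb G v)) => //.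
  by apply: filterS (Uv v) => F /= [Gv _]; rewrite mem_nb.
exists M => v; have PU : ProperFilter U := @ultra_proper _ _ uU.
have FU : Filter U := @filter_filter _ _ PU.
have /(@filter_ex _ _ PU)[F /= [[Gv mv] [e1 e2]]] :=
  @filterI _ _ FU _ _ (Uv v) (@filterI _ _ FU _ _ (MP v) (MP (M v))).
by rewrite -e2 -e1.
Qed.

Lemma perfect_matching_of_involution (m : V -> V) :
    (forall v, G v (m v) /\ m (m v) = v) ->
  exists M : set (set V), perfect_matching G M.
Proof.
move=> mP; exists [set [set v; m v] | v in setT]; split; last first.
  by move=> v; exists [set v; m v]; [exists v|left].
split=> [_ [v _ <-]|_ _ [u _ <-] [v _ <-]].
  by exists v, (m v); split=> //; case: (mP v).
case=> w [/= uw vw].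
have pairE x : [set x; m x] w -> [set x; m x] = [set w; m w].
  by case=> /= ->; [|rewrite (mP x).2 setUC].
by rewrite (pairE u) // (pairE v).
Qed.

End Compactness.

(** * Matchings covering a finite set of vertices *)

Section FiniteMatching.
Import mathcomp.boot.fintype mathcomp.boot.finset.
Variables (V : choiceType) (G : lfgraph V).

Lemma even_superset (s : seq V) : even_or_infinite V ->
  exists W : seq V, [/\ uniq W, {subset s <= W} & ~~ odd (size W)].
Proof.
move=> evV; have [odds|evs] := boolP (odd (size (undup s))); last first.
  by exists (undup s); split=> //; [exact: undup_uniq|move=> v; rewrite mem_undup].
suff [v vs] : exists v, v \notin s.
  exists (v :: undup s); split; rewrite /= ?odds // ?mem_undup ?vs ?undup_uniq //.
  by move=> u us; rewrite inE mem_undup us orbT.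
apply: contrapT => /forallNP alls.
pose X := [fset v in s]%fset.
have XT : [set` X]%classic = classical_sets.setT.
  apply/seteqP; split=> // v _ /=; rewrite in_fset /=.
  by have := alls v; case: (v \in s).
case: evV => [|[n]]; first by rewrite -XT; apply; exact: finite_fset.
by rewrite -XT => /card_eq_fsetP <-; rewrite card_fseq odds.
Qed.

Variable d : nat.
Hypotheses (d_gt0 : 0 < d) (nb_size : forall x, size (nb G x) = d).
Hypothesis odd_cut : forall C : seq V, uniq C -> odd (size C) ->
  d <= \sum_(v <- C) count [pred u | u \notin C] (nb G v).

Section Closure.
Variables (F W : seq V).
Hypotheses (uW : uniq W) (FW : forall v, v \in F -> {subset nb G v <= W}).

(** The graph induced on [W], with all the edges between vertices that do not
    belong to [F] added: its perfect matchings restrict to matchings of the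
    given graph that cover [F]. *)
Definition filled_adj : rel (seq_sub W) := fun p q =>
  G (val p) (val q) || (val p \notin F) && (val q \notin F).

Lemma filled_adj_sym : symmetric filled_adj.
Proof. by move=> p q; rewrite /filled_adj adj_sym andbC. Qed.

(** [C] consists of vertices of [F]. *)
Definition inner (C : {set seq_sub W}) := [forall p in C, val p \in F].

(** The edges leaving [C] at [p] all end in [S], since [W] contains the
    neighbours of [p]. *)
Lemma inner_degree (S C : {set seq_sub W}) p :
    odd_part filled_adj setT S C -> inner C -> p \in C ->
  count [pred u | u \notin [seq val q | q in C]] (nb G (val p))
    <= \sum_(q in S) G (val p) (val q).
Proof.
move=> /odd_partP[_ _ CS clC] /forall_inP inC pC.
have -> : \sum_(q in S) G (val p) (val q) =
    size [seq val q | q in [set q in S | G (val p) (val q)]].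
  rewrite size_map -cardE cardsE -sum1_card big_mkcondr /=.
  by apply: eq_bigr => q _; case: (G _ _).
rewrite -size_filter; apply: uniq_leq_size.
  by apply: filter_uniq; apply: nb_uniq.
move=> u; rewrite mem_filter /= => /andP[uC up].
have uW' : u \in W by apply: FW up; apply: inC.
apply/mapP; exists (SeqSub uW') => //.
rewrite mem_enum inE /= -mem_nb up andbT.
apply: contraR uC => uS; apply/mapP; exists (SeqSub uW') => //.
by rewrite mem_enum; apply: (clC p) => //; rewrite /filled_adj -mem_nb up.
Qed.

(** Each member is joined to [S] by at least [d] edges, and [S] is incident with
    at most [d * #|S|] edges. *)
Lemma inner_card (S : {set seq_sub W}) (P : {set {set seq_sub W}}) :
    odd_family filled_adj setT S P -> {in P, forall C, inner C} ->
  #|P| <= #|S|.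
Proof.
move=> fP innP; have /odd_familyP[_ oP] := fP; have /andP[tP _] := fP.
rewrite -(leq_pmul2r d_gt0) -!sum_nat_const.
pose cross (p : seq_sub W) := \sum_(q in S) (G (val p) (val q) : nat).
apply: (@leq_trans (\sum_(C in P) \sum_(p in C) cross p)).
  apply: leq_sum => C CP; have /odd_partP[oC _ _ _] := oP C CP.
  apply: leq_trans (odd_cut (C := [seq val q | q in C]) _ _) _.
  - by rewrite map_inj_uniq ?enum_uniq //; apply: val_inj.
  - by rewrite size_map -cardE.
  - rewrite big_map big_enum /=; apply: leq_sum => p pC.
    by apply: inner_degree (oP C CP) (innP C CP) pC.
rewrite -(big_trivIset _ tP) /= exchange_big /=; apply: leq_sum => q qS.
rewrite -(nb_size (val q)).
apply: (@leq_trans (size [seq val p | p in [set p | G (val q) (val p)]])).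
  rewrite size_map -cardE cardsE -sum1_card big_mkcond [leqRHS]big_mkcond /=.
  apply: leq_sum => p _; case: ifP => // _; rewrite adj_sym.
  by rewrite -topredE /=; case: (G _ _).
apply: uniq_leq_size; first by rewrite map_inj_uniq ?enum_uniq //; apply: val_inj.
by move=> _ /mapP[p + ->]; rewrite mem_enum inE mem_nb.
Qed.

(** At most one member of an odd family has a vertex outside [F], since all
    such vertices are adjacent. *)
Lemma outer_card (S : {set seq_sub W}) (P : {set {set seq_sub W}}) :
  odd_family filled_adj setT S P -> #|P| <= #|S|.+1.
Proof.
move=> fP; have /odd_familyP[dP oP] := fP.
pose P1 := [set C in P | inner C]; pose P2 := [set C in P | ~~ inner C].
have -> : #|P| = #|P1| + #|P2|.
  rewrite -(cardsID [set C | inner C] P); congr (_ + _); apply: eq_card => C.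
    by rewrite !inE.
  by rewrite !inE andbC.
rewrite -addn1; apply: leq_add.
  apply: inner_card => [|C]; last by rewrite inE => /andP[].
  apply/odd_familyP; split=> [C D|C]; rewrite !inE => /andP[CP _]; last exact: oP.
  by case/andP=> DP _; apply: dP.
apply/card_le1P => C; rewrite inE => /andP[CP /forall_inPn[p pC pF]] D.
rewrite [D \in pred1 C]inE; have [->|DC] := eqVneq D C.
  by rewrite inE CP; apply/forall_inPn; exists p.
apply/negbTE; rewrite inE; apply/negP => /andP[DP /forall_inPn[q qD qF]].
have /odd_partP[_ _ DS clD] := oP D DP; have /odd_partP[_ _ CS clC] := oP C CP.
have qC : q \in C.
  apply: (clC p) => //; first by rewrite /filled_adj pF qF orbT.
  by rewrite (disjointFr DS qD).
by have := dP D C DP CP DC; move/disjointFr/(_ qD); rewrite qC.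
Qed.

(** If [#|P|] were [#|S|.+1], parity would provide one more odd part, against
    [outer_card]. *)
Lemma filled_tutte : ~~ odd (size W) -> tutte_condition filled_adj setT.
Proof.
move=> evW S P ST fP; rewrite leqNgt; apply/negP => ltSP.
have cP : #|P| = #|S|.+1 by apply/eqP; rewrite eqn_leq ltSP outer_card.
have [|f2 c2] := odd_family_complete filled_adj_sym ST fP.
  rewrite cP cardsT card_seq_sub // addnS /= oddD oddD (negbTE evW) /=.
  by case: (odd _).
by have := outer_card f2; rewrite c2 cP ltnn.
Qed.

End Closure.

Lemma finite_matching (F : seq V) : even_or_infinite V ->
  exists m : V -> V, forall v, v \in F -> G v (m v) /\ m (m v) = v.
Proof.
move=> evV.
have [W [uW sW evW]] := even_superset (F ++ flatten [seq nb G v | v <- F]) evV.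
have FW v : v \in F -> {subset nb G v <= W}.
  move=> vF u uv; apply: sW; rewrite mem_cat; apply/orP; right.
  by apply/flatten_mapP; exists v.
have [m mP] := tutte (@filled_adj_sym F W) (filled_tutte uW FW evW).
exists (fun v => if insub v is Some p then val (m p) else v) => v vF.
have vW : v \in W by apply: sW; rewrite mem_cat vF.
have [_ mm em] := mP (SeqSub vW) (in_setT _).
rewrite insubT /= -[Sub v vW]/(SeqSub vW) valK mm; split=> //.
by move: em; rewrite /filled_adj /= vF orbF.
Qed.

End FiniteMatching.

(** * The curvature inequality at a vertex *)

Section Curvature.
Import GRing.Theory Num.Theory Order.TTheory.
Local Open Scope ring_scope.
Variables (R : realType) (V : choiceType) (G : lfgraph V).
Implicit Types (f g : V -> R) (x y : V).

Lemma laplacianE f x : laplacian G f x = \sum_(y <- nb G x) (f y - f x).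
Proof. by rewrite /laplacian fsbig_finite //; exact: adj_locally_finite. Qed.

Lemma GammaE f g x :
  Gamma G f g x = 2^-1 * \sum_(y <- nb G x) (f y - f x) * (g y - g x).
Proof.
rewrite /Gamma !laplacianE; congr (_ * _).
rewrite mulr_suml mulr_sumr -!sumrB; apply: eq_bigr => y _ /=; ring.
Qed.

Lemma Gamma_ge0 f x : 0 <= Gamma G f f x.
Proof.
rewrite GammaE mulr_ge0 ?invr_ge0 //; apply: sumr_ge0 => y _.
by rewrite -expr2 sqr_ge0.
Qed.

(** The supremum defining the curvature at [x] need not be attained a priori:
    the bound by [0] is a limit of the bounds by small negative constants. *)
Lemma CD0_of_curvature_ge0 x : (0 <= BE_curvature R G)%E -> CD_infty G (0 : R) x.
Proof.
move=> BE0 f; rewrite mul0r.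
have BEx : (0 <= BE_curvature_at R G x)%E.
  by apply: le_trans BE0 _; apply: ereal_inf_lbound; exists x.
apply/ler_addgt0Pr => eps eps0.
have G1 : 0 < Gamma G f f x + 1 by rewrite ltr_wpDl // Gamma_ge0.
pose del := eps / (Gamma G f f x + 1).
have del0 : 0 < del by rewrite divr_gt0.
have : ((- del)%:E < BE_curvature_at R G x)%E.
  by apply: lt_le_trans BEx; rewrite lte_fin oppr_lt0.
case/ereal_sup_gt => _ [K /= CDK <-]; rewrite lte_fin => delK.
have := CDK f; have := Gamma_ge0 f x; move: delK.
have : del * (Gamma G f f x + 1) = eps by rewrite /del divfK // gt_eqF.
set g := Gamma _ _ _ _; set g2 := Gamma2 _ _ _ _; nra.
Qed.

Variable d : nat.
Hypothesis nb_size : forall x, size (nb G x) = d.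

(** The form four times [Gamma2 f f x], for [f] vanishing at [x], is that of the
    conclusion: only the values of [f] on the first two spheres matter. *)
Lemma CD0_regular x f : CD_infty G (0 : R) x -> f x = 0 ->
  0 <= \sum_(y <- nb G x) \sum_(z <- nb G y) (f z - 2 * f y) ^+ 2
       - 2 * d%:R * \sum_(y <- nb G x) f y ^+ 2
       + 2 * (\sum_(y <- nb G x) f y) ^+ 2.
Proof.
move=> /(_ f); rewrite mul0r => CD fx.
suff <- : 4 * Gamma2 G f f x =
    \sum_(y <- nb G x) \sum_(z <- nb G y) (f z - 2 * f y) ^+ 2
       - 2 * d%:R * \sum_(y <- nb G x) f y ^+ 2
       + 2 * (\sum_(y <- nb G x) f y) ^+ 2 by rewrite mulr_ge0.
have sum_const y (a : R) : \sum_(z <- nb G y) a = d%:R * a.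
  by rewrite big_const_seq count_predT nb_size iter_addr_0 mulr_natl.
set s := \sum_(y <- nb G x) f y; set N := \sum_(y <- nb G x) f y ^+ 2.
have lapx : laplacian G f x = s.
  by rewrite laplacianE; apply: eq_bigr => y _; rewrite fx subr0.
have Gx : Gamma G f f x = 2^-1 * N.
  by rewrite GammaE; congr (_ * _); apply: eq_bigr => y _; rewrite fx subr0 expr2.
have Gy y : Gamma G f f y = 2^-1 * (\sum_(z <- nb G y) (f z - 2 * f y) ^+ 2
    + 2 * f y * laplacian G f y - d%:R * f y ^+ 2).
  rewrite GammaE laplacianE -(sum_const y); congr (_ * _).
  by rewrite mulr_sumr -big_split -sumrB /=; apply: eq_bigr => z _; ring.
have GL : Gamma G f (laplacian G f) x =
    2^-1 * (\sum_(y <- nb G x) f y * laplacian G f y - s ^+ 2).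
  rewrite GammaE lapx expr2 mulr_suml -sumrB; congr (_ * _).
  by apply: eq_bigr => y _; rewrite fx; ring.
have LG : laplacian G (Gamma G f f) x =
    2^-1 * (\sum_(y <- nb G x) \sum_(z <- nb G y) (f z - 2 * f y) ^+ 2
      + 2 * \sum_(y <- nb G x) f y * laplacian G f y - 2 * d%:R * N).
  rewrite laplacianE sumrB sum_const Gx.
  under eq_bigr do rewrite Gy.
  rewrite -mulr_sumr sumrB big_split /= -mulr_sumr -/N.
  rewrite (_ : \sum_(y <- nb G x) 2 * f y * _ =
    2 * \sum_(y <- nb G x) f y * laplacian G f y); last first.
    by rewrite mulr_sumr; apply: eq_bigr => y _; rewrite mulrA.
  by field.
have GC : Gamma G (laplacian G f) f x = Gamma G f (laplacian G f) x.
  by rewrite !GammaE; congr (_ * _); apply: eq_bigr => y _; rewrite mulrC.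
by rewrite /Gamma2 GC GL LG; field.
Qed.

End Curvature.

(** * Cuts *)

Section Cuts.
Variables (V : choiceType) (G : lfgraph V).
Implicit Types (C : pred V) (A B : seq V).

(** Exchange of the summations over the ordered pairs of adjacent vertices in
    [A] and [B]. *)
Lemma exchange_nb (T : Type) (idx : T) (op : Monoid.com_law idx) A B
    (F : V -> V -> T) : uniq A -> uniq B ->
  \big[op/idx]_(y <- A) \big[op/idx]_(z <- nb G y | z \in B) F y z =
  \big[op/idx]_(z <- B) \big[op/idx]_(y <- nb G z | y \in A) F y z.
Proof.
move=> uA uB.
have nbE D y (H : V -> T) : uniq D -> \big[op/idx]_(z <- nb G y | z \in D) H z =
    \big[op/idx]_(z <- D | G y z) H z.
  move=> uD; rewrite -big_filter -[RHS]big_filter; apply: perm_big.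
  apply: uniq_perm; rewrite ?filter_uniq ?nb_uniq // => z.
  by rewrite !mem_filter mem_nb andbC.
rewrite (eq_bigr _ (fun y _ => nbE B y _ uB)) (exchange_big_dep predT) //=.
apply: eq_bigr => z _; rewrite nbE //.
by apply: eq_bigl => y; rewrite adj_sym.
Qed.

(** Double counting of the edges between two sets. *)
Lemma edge_double_count A B : uniq A -> uniq B ->
  \sum_(y <- A) count (mem B) (nb G y) = \sum_(z <- B) count (mem A) (nb G z).
Proof.
move=> uA uB; have := exchange_nb addn (fun _ _ => 1) uA uB.
by rewrite (eq_bigr _ (fun y _ => sum1_count _ _))
  [in RHS](eq_bigr _ (fun y _ => sum1_count _ _)).
Qed.

(** The number of edges at [v] that join [C] to its complement. *)
Definition cross C v := count [pred u | C u != C v] (nb G v).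

(** At most [m] edges join [C] to its complement.  Both sides may be infinite,
    hence the bound is on finite parts of the cut. *)
Definition cut_le C m :=
  forall W : seq V, uniq W -> \sum_(v <- W | C v) cross C v <= m.

Lemma cross_predC C v : cross (predC C) v = cross C v.
Proof. by apply: eq_count => u /=; case: (C u); case: (C v). Qed.

Lemma cut_le_predC C m : cut_le C m -> cut_le (predC C) m.
Proof.
move=> Cm W uW; pose A := [seq v <- W | predC C v].
pose B := [seq u <- undup (flatten [seq nb G v | v <- A]) | C u].
have uA : uniq A by apply: filter_uniq.
have uB : uniq B by apply: filter_uniq; apply: undup_uniq.
apply: leq_trans (Cm B uB).
rewrite -big_filter -/A [leqRHS]big_filter_cond.
have -> : \sum_(v <- A) cross (predC C) v = \sum_(v <- A) count (mem B) (nb G v).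
  apply: eq_big_seq => v vA; rewrite cross_predC; apply: eq_in_count => u uv /=.
  have Cv : C v = false by move: vA; rewrite mem_filter => /andP[/negbTE].
  rewrite Cv mem_filter mem_undup; case: (C u) => //=; apply/esym.
  by apply/flatten_mapP; exists v.
rewrite edge_double_count // /B big_filter.
rewrite [leqRHS](eq_bigl C) => [|u]; last by rewrite andbb.
apply: leq_sum => u Cu; apply: sub_count => v /=.
by rewrite mem_filter Cu => /andP[/= /negbTE->].
Qed.

Lemma cross_exists C u v : connected_graph G -> C u -> ~~ C v ->
  exists x, 0 < cross C x.
Proof.
move=> conn Cu Cv; have [p] := conn u v.
elim: p u Cu => [|w p IH] u Cu /=; first by move=> _ uv; rewrite -uv Cu in Cv.
case/andP => uw pw lp; have [Cw|Cw] := boolP (C w); first exact: (IH w).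
exists u; rewrite /cross -has_count; apply/hasP; exists w; rewrite ?mem_nb //=.
by rewrite Cu (negbTE Cw).
Qed.

End Cuts.

(** * Test functions on the two spheres around a vertex *)

Section Spheres.
Import GRing.Theory Num.Theory Order.TTheory.
Local Open Scope ring_scope.
Variables (R : realType) (V : choiceType) (G : lfgraph V) (d : nat).
Hypothesis nb_size : forall x, size (nb G x) = d.
Variable x : V.

(** The vertices at distance two from [x]. *)
Definition sphere2 : seq V :=
  [seq z <- undup (flatten [seq nb G y | y <- nb G x]) | (z != x) && ~~ G x z].

Lemma sphere2_uniq : uniq sphere2.
Proof. by rewrite filter_uniq ?undup_uniq. Qed.

Lemma mem_sphere2 z :
  (z \in sphere2) = [&& z != x, ~~ G x z & has (G z) (nb G x)].
Proof.
rewrite mem_filter mem_undup -andbA; congr (_ && (_ && _)).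
apply/flatten_mapP/hasP => -[y yx yz]; exists y => //.
  by rewrite adj_sym -mem_nb.
by rewrite mem_nb adj_sym.
Qed.

Lemma spheres_uniq : uniq (nb G x ++ sphere2).
Proof.
rewrite cat_uniq nb_uniq sphere2_uniq andbT /=; apply/hasPn => z.
by rewrite mem_sphere2 mem_nb => /and3P[].
Qed.

(** The contribution to the form of the walks of length two from [x] to [z]. *)
Definition sphere_energy (f : V -> R) z : R :=
  \sum_(y <- nb G z | G x y) (f z - 2 * f y) ^+ 2.

(** The walks that return to [x] contribute [4 (f y)^2] each, whence the
    coefficient [2 d - 4]. *)
Lemma CD0_spheres f : CD_infty G (0 : R) x -> f x = 0 ->
  0 <= \sum_(z <- nb G x) sphere_energy f z + \sum_(z <- sphere2) sphere_energy f z
    - (2 * d%:R - 4) * \sum_(y <- nb G x) f y ^+ 2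
    + 2 * (\sum_(y <- nb G x) f y) ^+ 2.
Proof.
move=> CD fx; have := CD0_regular nb_size CD fx.
have uW : uniq (x :: nb G x ++ sphere2).
  rewrite /= spheres_uniq andbT mem_cat mem_nb adj_irrefl /=.
  by rewrite mem_sphere2 eqxx.
rewrite (eq_big_seq (fun y =>
    \sum_(z <- nb G y | z \in x :: nb G x ++ sphere2) (f z - 2 * f y) ^+ 2)); last first.
  move=> y yx; rewrite -[in RHS]big_filter; congr (\sum_(z <- _) _).
  apply/esym/all_filterP/allP => z zy; rewrite !inE mem_cat mem_sphere2 mem_nb.
  have [//|/= zx] := eqVneq z x; case: (G x z) => //=.
  by apply/hasP; exists y => //; rewrite adj_sym -mem_nb.
rewrite (exchange_nb G +%R) ?nb_uniq // big_cons big_cat /=.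
have energyE z : \sum_(y <- nb G z | y \in nb G x) (f z - 2 * f y) ^+ 2 =
    sphere_energy f z by apply: eq_bigl => y; rewrite mem_nb.
rewrite (eq_bigr _ (fun z _ => energyE z)).
rewrite [X in _ + (_ + X)](eq_bigr _ (fun z _ => energyE z)).
rewrite energyE.
have -> : sphere_energy f x = 4 * \sum_(y <- nb G x) f y ^+ 2.
  rewrite /sphere_energy (eq_bigl (mem (nb G x))) => [|y]; last by rewrite inE mem_nb.
  rewrite -big_seq mulr_sumr; apply: eq_bigr => y _; rewrite fx; ring.
by move=> H; apply: le_trans H _; rewrite le_eqVlt; apply/orP; left; apply/eqP; ring.
Qed.

End Spheres.

(** * Two-valued test functions *)

Lemma count_sum (T : Type) (p : pred T) (s : seq T) :
  count p s = \sum_(u <- s) p u.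
Proof. by elim: s => [|u s IH]; rewrite ?big_nil ?big_cons //= IH. Qed.

Section TwoValues.
Import GRing.Theory Num.Theory Order.TTheory.
Local Open Scope ring_scope.
Variables (R : realType) (V : choiceType) (G : lfgraph V) (d : nat).
Hypothesis nb_size : forall x, size (nb G x) = d.
Variables (C : pred V) (x : V).
Hypothesis Cx : ~~ C x.

(** The neighbours of [x], and the vertices at distance two, on each side of
    the cut. *)
Definition nb_in := [seq y <- nb G x | C y].
Definition nb_out := [seq y <- nb G x | ~~ C y].
Definition sphere2_in := [seq z <- sphere2 G x | C z].
Definition sphere2_out := [seq z <- sphere2 G x | ~~ C z].

(** The numbers of common neighbours of [z] and [x] on each side. *)
Definition deg_in z := count (mem nb_in) (nb G z).
Definition deg_out z := count (mem nb_out) (nb G z).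

(** The numbers of cut edges inside the first sphere around [x], and of those
    between the spheres with their end in [C] on the second, respectively the
    first, sphere. *)
Definition cut1 := (\sum_(z <- nb_in) deg_out z)%N.
Definition cut2_in := (\sum_(z <- sphere2_in) deg_out z)%N.
Definition cut2_out := (\sum_(z <- sphere2_out) deg_in z)%N.

Let n := cross G C x.
Let a := size nb_out.

Lemma size_nb_in : size nb_in = n.
Proof.
by rewrite size_filter; apply: eq_count => u /=; rewrite (negbTE Cx); case: (C u).
Qed.

Lemma size_nb_in_out : (n + a = d)%N.
Proof. by rewrite -size_nb_in /a !size_filter -(nb_size x) -(count_predC C). Qed.

Lemma nb_in_uniq : uniq nb_in. Proof. by rewrite filter_uniq ?nb_uniq. Qed.
Lemma nb_out_uniq : uniq nb_out. Proof. by rewrite filter_uniq ?nb_uniq. Qed.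
Lemma sphere2_in_uniq : uniq sphere2_in.
Proof. by rewrite filter_uniq ?sphere2_uniq. Qed.
Lemma sphere2_out_uniq : uniq sphere2_out.
Proof. by rewrite filter_uniq ?sphere2_uniq. Qed.

Lemma mem_nb_in z : (z \in nb_in) = C z && G x z.
Proof. by rewrite mem_filter mem_nb. Qed.
Lemma mem_nb_out z : (z \in nb_out) = ~~ C z && G x z.
Proof. by rewrite mem_filter mem_nb. Qed.

Lemma deg_in_lt z : z \in nb_in -> (deg_in z + 1 <= n)%N.
Proof.
move=> zY; rewrite -size_nb_in addn1 /deg_in -size_filter.
have sub : {subset z :: [seq y <- nb G z | y \in nb_in] <= nb_in}.
  by move=> y; rewrite inE mem_filter => /predU1P[->|/andP[]].
apply: (uniq_leq_size _ sub) => /=.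
by rewrite mem_filter mem_nb adj_irrefl andbF filter_uniq ?nb_uniq.
Qed.

Lemma deg_out_lt z : z \in nb_out -> (deg_out z + 1 <= a)%N.
Proof.
move=> zY; rewrite addn1 /deg_out -size_filter.
have sub : {subset z :: [seq y <- nb G z | y \in nb_out] <= nb_out}.
  by move=> y; rewrite inE mem_filter => /predU1P[->|/andP[]].
apply: (uniq_leq_size _ sub) => /=.
by rewrite mem_filter mem_nb adj_irrefl andbF filter_uniq ?nb_uniq.
Qed.

Lemma deg_in_le z : (deg_in z <= n)%N.
Proof.
rewrite -size_nb_in /deg_in -size_filter.
apply: uniq_leq_size; first by rewrite filter_uniq ?nb_uniq.
by move=> y; rewrite mem_filter => /andP[].
Qed.

Lemma sum_deg_in_out : (\sum_(z <- nb_out) deg_in z = cut1)%N.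
Proof. by rewrite -edge_double_count ?nb_in_uniq ?nb_out_uniq. Qed.

Lemma cross_nb_in z : z \in nb_in ->
  (1 + deg_out z + count (mem sphere2_out) (nb G z) <= cross G C z)%N.
Proof.
rewrite mem_nb_in => /andP[Cz xz].
have -> : (1 = count (pred1 x) (nb G z))%N.
  by rewrite count_uniq_mem ?nb_uniq // mem_nb adj_sym xz.
rewrite /deg_out /cross !count_sum -!big_split /=.
apply: leq_sum => u _; rewrite mem_nb_out mem_filter mem_sphere2 Cz.
have [->|_] := eqVneq u x; first by rewrite adj_irrefl (negbTE Cx).
by case: (C u); case: (G x u); case: (has _ _).
Qed.

Lemma cross_sphere2_in z : z \in sphere2_in -> (deg_out z <= cross G C z)%N.
Proof.
rewrite mem_filter => /andP[Cz _]; apply: sub_count => u /=.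
by rewrite mem_nb_out Cz => /andP[/negbTE->].
Qed.

(** The edges counted by [n], [cut1] and [cut2_out] are distinct edges of the cut
    incident with neighbours of [x] in [C]. *)
Lemma cut_around : (n + cut1 + cut2_out <= \sum_(z <- nb_in) cross G C z)%N.
Proof.
rewrite /cut2_out -edge_double_count ?nb_in_uniq ?sphere2_out_uniq //.
rewrite -size_nb_in -sum1_size /cut1 -!big_split /= big_seq [leqRHS]big_seq.
by apply: leq_sum => z zY; apply: cross_nb_in.
Qed.

Lemma cut_count m : cut_le G C m -> (n + cut1 + cut2_out + cut2_in <= m)%N.
Proof.
move/(_ _ (spheres_uniq G x)); rewrite big_cat /=; apply: leq_trans.
apply: leq_add; first by apply: leq_trans cut_around _; rewrite big_filter.
rewrite -[leqRHS]big_filter /cut2_in big_seq [leqRHS]big_seq.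
by apply: leq_sum => z zP; apply: cross_sphere2_in.
Qed.

Section TestFunction.
Variable s : R.

(** On the neighbours of [x] this is the indicator of [C] shifted by [s].  At
    distance two it is twice the value on the same side, except at the vertices
    of [C] incident with a cut edge: the correction [2 / n.+1] minimises the
    energy when all the [n] neighbours of [x] in [C], but just one of the others,
    are neighbours of the vertex. *)
Definition two_value_test v : R :=
  if v == x then 0 else
  if G x v then (C v)%:R - s else
  if C v then 2 - 2 * s - (if deg_out v == 0%N then 0 else 2 / n.+1%:R)
  else - 2 * s.

Let f := two_value_test.

Lemma test_nb_in y : y \in nb_in -> f y = 1 - s.
Proof.
rewrite mem_nb_in => /andP[Cy xy]; rewrite /f /two_value_test xy Cy.
by case: eqVneq xy => [->|//]; rewrite adj_irrefl.
Qed.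

Lemma test_nb_out y : y \in nb_out -> f y = - s.
Proof.
rewrite mem_nb_out => /andP[/negbTE Cy xy]; rewrite /f /two_value_test xy Cy.
by case: eqVneq xy => [->|_]; rewrite ?adj_irrefl // sub0r.
Qed.

Lemma sum_nb_split (F : V -> R) :
  \sum_(y <- nb G x) F y = \sum_(y <- nb_in) F y + \sum_(y <- nb_out) F y.
Proof. by rewrite (bigID C) /= !big_filter. Qed.

Lemma energy_two_value z : sphere_energy G x f z =
  (deg_in z)%:R * (f z - 2 * (1 - s)) ^+ 2 + (deg_out z)%:R * (f z + 2 * s) ^+ 2.
Proof.
rewrite /sphere_energy (bigID C) /=; congr (_ + _).
  rewrite (eq_bigl (mem nb_in)) => [|y]; last by rewrite inE mem_nb_in andbC.
  rewrite (eq_bigr (fun=> (f z - 2 * (1 - s)) ^+ 2)) => [|y yY].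
    by rewrite big_const_seq iter_addr_0 -[LHS]mulr_natl.
  by rewrite (test_nb_in yY).
rewrite (eq_bigl (mem nb_out)) => [|y]; last by rewrite inE mem_nb_out andbC.
rewrite (eq_bigr (fun=> (f z + 2 * s) ^+ 2)) => [|y yO].
  by rewrite big_const_seq iter_addr_0 -[LHS]mulr_natl.
by rewrite (test_nb_out yO) mulrN opprK.
Qed.

Lemma sum_const_seq A (c : R) : \sum_(y <- A : seq V) c = (size A)%:R * c.
Proof. by rewrite big_const_seq count_predT iter_addr_0 mulr_natl. Qed.

Lemma energy_nb_in : \sum_(z <- nb_in) sphere_energy G x f z <=
  n%:R * (n%:R - 1) * (1 - s) ^+ 2 + cut1%:R * (1 + s) ^+ 2.
Proof.
rewrite -size_nb_in -mulrA -sum_const_seq /cut1 natr_sum mulr_suml -big_split /=.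
rewrite big_seq [leRHS]big_seq; apply: ler_sum => z zY.
rewrite energy_two_value test_nb_in //; apply: lerD; last first.
  by rewrite le_eqVlt; apply/orP; left; apply/eqP; ring.
have -> : (1 - s - 2 * (1 - s)) ^+ 2 = (1 - s) ^+ 2 :> R by ring.
rewrite ler_wpM2r ?sqr_ge0 // lerBrDr size_nb_in natr1 ler_nat -addn1.
exact: deg_in_lt.
Qed.

Lemma energy_nb_out : \sum_(z <- nb_out) sphere_energy G x f z <=
  cut1%:R * (2 - s) ^+ 2 + a%:R * (a%:R - 1) * s ^+ 2.
Proof.
rewrite -mulrA -sum_const_seq -sum_deg_in_out natr_sum mulr_suml -big_split /=.
rewrite big_seq [leRHS]big_seq; apply: ler_sum => z zY.
rewrite energy_two_value test_nb_out //; apply: lerD.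
  by rewrite le_eqVlt; apply/orP; left; apply/eqP; ring.
have -> : (- s + 2 * s) ^+ 2 = s ^+ 2 :> R by ring.
rewrite ler_wpM2r ?sqr_ge0 // lerBrDr natr1 ler_nat -addn1.
exact: deg_out_lt.
Qed.

Lemma energy_sphere2_in : \sum_(z <- sphere2_in) sphere_energy G x f z <=
  4 * n%:R / n.+1%:R * cut2_in%:R.
Proof.
rewrite /cut2_in natr_sum mulr_sumr big_seq [leRHS]big_seq.
apply: ler_sum => z; rewrite mem_filter mem_sphere2 => /andP[Cz /and3P[zx xz _]].
rewrite energy_two_value /f /two_value_test (negbTE zx) (negbTE xz) Cz.
have [-> |k0] := eqVneq (deg_out z) 0%N.
  by rewrite mulr0 mul0r addr0 subr0 le_eqVlt; apply/orP; left; apply/eqP; ring.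
have k1 : 1 <= (deg_out z)%:R :> R by rewrite ler1n lt0n.
have pn : (deg_in z)%:R <= n%:R :> R by rewrite ler_nat deg_in_le.
have n0 : 0 <= n%:R :> R by [].
move: (deg_in z)%:R (deg_out z)%:R pn k1 => p k pn k1.
have -> : n.+1%:R = n%:R + 1 :> R by rewrite natr1.
move: n%:R n0 pn => N N0 pN.
have N1 : 0 < N + 1 by rewrite ltr_wpDl.
have -> : p * (2 - 2 * s - 2 / (N + 1) - 2 * (1 - s)) ^+ 2 +
    k * (2 - 2 * s - 2 / (N + 1) + 2 * s) ^+ 2 =
    4 * (p + k * N ^+ 2) / (N + 1) ^+ 2.
  by field; rewrite gt_eqF.
rewrite ler_pdivrMr ?exprn_gt0 //.
have -> : 4 * N / (N + 1) * k * (N + 1) ^+ 2 = 4 * (N * k + k * N ^+ 2).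
  by field; rewrite gt_eqF.
rewrite ler_pM2l // lerD2r; apply: le_trans pN _.
by rewrite ler_peMr.
Qed.

Lemma energy_sphere2_out : \sum_(z <- sphere2_out) sphere_energy G x f z <=
  4 * cut2_out%:R.
Proof.
rewrite /cut2_out natr_sum mulr_sumr big_seq [leRHS]big_seq.
apply: ler_sum => z; rewrite mem_filter mem_sphere2 => /andP[Cz /and3P[zx xz _]].
rewrite energy_two_value /f /two_value_test (negbTE zx) (negbTE xz) (negbTE Cz).
by rewrite le_eqVlt; apply/orP; left; apply/eqP; ring.
Qed.

(** In the bound, edges inside either half of the first sphere are as numerous
    as possible. *)
Lemma two_value_ineq : CD_infty G (0 : R) x ->
  0 <= n%:R * (n%:R - 1) * (1 - s) ^+ 2
     + cut1%:R * ((1 + s) ^+ 2 + (2 - s) ^+ 2) + a%:R * (a%:R - 1) * s ^+ 2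
     + 4 * n%:R / n.+1%:R * cut2_in%:R + 4 * cut2_out%:R
     - (2 * d%:R - 4) * (n%:R * (1 - s) ^+ 2 + a%:R * s ^+ 2)
     + 2 * (n%:R * (1 - s) - a%:R * s) ^+ 2.
Proof.
move=> CD; have fx : f x = 0 by rewrite /f /two_value_test eqxx.
have := CD0_spheres nb_size CD fx; rewrite !sum_nb_split.
rewrite [X in _ + X - _](bigID C) /=.
rewrite -[\sum_(z <- sphere2 G x | C z) _]big_filter.
rewrite -[\sum_(z <- sphere2 G x | ~~ C z) _]big_filter.
rewrite -/sphere2_in -/sphere2_out.
have -> : \sum_(y <- nb_in) f y ^+ 2 = n%:R * (1 - s) ^+ 2.
  rewrite -size_nb_in -sum_const_seq big_seq [RHS]big_seq.
  by apply: eq_bigr => y yY; rewrite test_nb_in.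
have -> : \sum_(y <- nb_out) f y ^+ 2 = a%:R * s ^+ 2.
  rewrite -sum_const_seq big_seq [RHS]big_seq.
  by apply: eq_bigr => y yY; rewrite test_nb_out // sqrrN.
have -> : \sum_(y <- nb_in) f y = n%:R * (1 - s).
  rewrite -size_nb_in -sum_const_seq big_seq [RHS]big_seq.
  by apply: eq_bigr => y yY; rewrite test_nb_in.
have -> : \sum_(y <- nb_out) f y = - (a%:R * s).
  rewrite -mulrN -sum_const_seq big_seq [RHS]big_seq.
  by apply: eq_bigr => y yY; rewrite test_nb_out.
have := energy_nb_in; have := energy_nb_out.
have := energy_sphere2_in; have := energy_sphere2_out; rewrite -/f.
set e1 := \sum_(z <- nb_in) _; set e2 := \sum_(z <- nb_out) _.
set e3 := \sum_(z <- sphere2_in) _; set e4 := \sum_(z <- sphere2_out) _.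
set F := _ * (_ + _); set H := 2 * _ ^+ 2; set b3 := _ * cut2_in%:R.
lra.
Qed.

End TestFunction.
End TwoValues.

(** * An inequality between natural numbers *)

Lemma cut_arithmetic_ge3 (n a t r q D : nat) :
    D = 2 * t + n * n + a * a + 3 * (n + a) ->
    n.+1 * ((t + n * n + 3 * n) * (t + n * n + 3 * n)) + n.+1 * (2 * (n + a) * n * D)
      <= (n.+1 * (5 * t + 4 * r + 3 * (n * n) + 3 * n) + 4 * n * q) * D ->
    3 <= n <= a -> n + t + r + q + 2 <= n + a -> False.
Proof.
move=> DE H /andP[n3 na] le2.
have D0 : 0 < D by rewrite DE; lia.
have {}H : (t + n * n + 3 * n) * (t + n * n + 3 * n) + 2 * (n + a) * n * D
    <= (5 * (a - 2) + 3 * (n * n) + 3 * n) * D.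
  rewrite -(leq_pmul2l (ltn0Sn n)) mulnDr; apply: leq_trans H _.
  rewrite [leqRHS]mulnA leq_mul2r; apply/orP; right.
  have : 4 * n * q <= n.+1 * (5 * q) by nia.
  have : n.+1 * (5 * t + 4 * r + 3 * (n * n) + 3 * n + 5 * q) <=
    n.+1 * (5 * (a - 2) + 3 * (n * n) + 3 * n) by rewrite leq_pmul2l //; lia.
  rewrite mulnDr; lia.
have {H} [A [AE A1 H]] : exists A,
  [/\ A + 2 * (n + a) * n = 5 * (a - 2) + 3 * (n * n) + 3 * n,
    0 < A & (n * n + 3 * n) * (n * n + 3 * n) <= A * D].
  have lt : 2 * (n + a) * n < 5 * (a - 2) + 3 * (n * n) + 3 * n.
    rewrite -(ltn_pmul2r D0); apply: leq_trans H.
    rewrite -[X in X < _]add0n ltn_add2r; nia.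
  exists (5 * (a - 2) + 3 * (n * n) + 3 * n - 2 * (n + a) * n); split; [lia|lia|].
  rewrite mulnBl leq_subRL; last by rewrite leq_mul2r (ltnW lt) orbT.
  rewrite addnC; apply: leq_trans H; rewrite leq_add2r.
  by apply: leq_mul; lia.
(* The positivity of [A] leaves finitely many values of [n] and [m]. *)
have [m mE] : exists m, a = n + m by exists (a - n); lia.
rewrite mE in AE le2 DE.
have {AE} e1 : A + 10 + 2 * (n * m) + n * n = 8 * n + 5 * m by lia.
have nm : 3 * m <= n * m by rewrite leq_mul2r n3 orbT.
have n6 : n <= 6.
  rewrite leqNgt; apply/negP => n7.
  have : 7 * n <= n * n by rewrite leq_mul2r n7 orbT.
  move=> n7'; have n11 : 11 <= n by lia.
  have : 11 * n <= n * n by rewrite leq_mul2r n11 orbT.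
  lia.
have n8 : 8 * n <= n * n + 16 by clear -n6; move: n n6; do 7 (case=> //).
have m5 : m <= 5 by lia.
have AE : A = 8 * n + 5 * m - (10 + 2 * (n * m) + n * n) by lia.
have tm : t + 2 <= n + m by lia.
rewrite {D D0 e1}DE {}AE in H A1.
clear na mE nm n8 le2 r q a.
case: n n3 n6 H A1 tm => [//|[//|[//|[|[|[|[|n]]]]]]] _ n6; last by [].
all: case: m m5 => [|[|[|[|[|[|m]]]]]] m5; last by [].
all: lia.
Qed.

Lemma cut_arithmetic_2 (a t r q D : nat) :
    D = 2 * t + 4 + a * a + 3 * (2 + a) ->
    3 * ((t + 10) * (t + 10)) + 3 * (4 * (2 + a) * D)
      <= (3 * (5 * t + 4 * r + 18) + 8 * q) * D ->
    t + r <= 2 -> t + r + q + 2 <= a -> t = 2 /\ (a = 4 \/ a = 5).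
Proof.
move=> DE H tr le2.
have D0 : 0 < D by rewrite DE; lia.
have {}H : 3 * ((t + 10) * (t + 10)) + 4 * a * D <= (7 * t + 4 * r + 14) * D.
  rewrite -(leq_add2r ((8 * a + 24) * D)) -[leqRHS]mulnDl.
  apply: leq_trans (leq_trans H _); first lia.
  by rewrite leq_mul2r; apply/orP; right; lia.
have a6 : a <= 6.
  have : 4 * a * D < (7 * t + 4 * r + 14) * D by apply: leq_trans H; lia.
  by rewrite ltn_mul2r => /andP[_]; lia.
have t2 : t <= 2 by lia.
have {}le2 : t + r + 2 <= a by lia.
clear D0 q; subst D.
case: t t2 tr le2 H => [|[|[|t]]] t2 tr le2 H; last by [].
all: case: r tr le2 H => [|[|[|r]]] tr le2 H //.
all: by case: a a6 le2 H => [|[|[|[|[|[|[|a]]]]]]] a6 le2 H //; try lia; auto.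
Qed.

(** Here [n] and [a] are the numbers of neighbours of a vertex on either side of
    the cut, so that [n + a] is the degree; [t], [r] and [q] stand for [cut1],
    [cut2_out] and [cut2_in]. *)
Lemma cut_arithmetic (n a t r q D : nat) :
    D = 2 * t + n * n + a * a + 3 * (n + a) ->
    n.+1 * ((t + n * n + 3 * n) * (t + n * n + 3 * n)) + n.+1 * (2 * (n + a) * n * D)
      <= (n.+1 * (5 * t + 4 * r + 3 * (n * n) + 3 * n) + 4 * n * q) * D ->
    0 < n <= a -> n + t + r <= n * n -> n + t + r + q + 2 <= n + a ->
  [/\ n = 2, t = 2 & n + a = 6 \/ n + a = 7].
Proof.
move=> DE H /andP[n0 na] le1 le2.
case: n n0 na le1 le2 DE H => [//|[|[|n]]] _ na le1 le2 DE H.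
- have [t0 r0] : t = 0 /\ r = 0 by lia.
  rewrite {}t0 {}r0 in le1 le2 DE H *.
  have D0 : 0 < D by rewrite DE; lia.
  have : 12 + 4 * q <= 4 * (1 + a) by lia.
  by rewrite -(leq_pmul2r D0); lia.
- have [||||-> a45] := @cut_arithmetic_2 a t r q D; [lia|lia|lia|lia|].
  by split=> //; case: a45 => ->; [left|right].
- by case: (cut_arithmetic_ge3 DE H); lia.
Qed.

(** * Vertices with the most neighbours across a cut *)

Section MaximalVertex.
Import GRing.Theory Num.Theory Order.TTheory.
Variables (R : realType) (V : choiceType) (G : lfgraph V) (d : nat).
Hypothesis nb_size : forall x, size (nb G x) = d.
Hypothesis CD0 : forall x, CD_infty G (0%R : R) x.

Lemma discriminant_le0 (A B D : R) : (0 < D)%R ->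
  (forall s, 0 <= A - 2 * B * s + D * s ^+ 2)%R -> (B ^+ 2 <= A * D)%R.
Proof.
move=> D0 /(_ (B / D)%R).
have -> : (A - 2 * B * (B / D) + D * (B / D) ^+ 2 = (A * D - B ^+ 2) / D)%R.
  by field; rewrite gt_eqF.
by rewrite pmulr_lge0 ?invr_gt0 // subr_ge0.
Qed.

(** The inequality [B^2 <= A D] between the coefficients of the polynomial
    [A - 2 B s + D s^2] of [two_value_ineq], multiplied by [n.+1]. *)
Lemma two_value_nat (C : pred V) x : ~~ C x ->
  let n := cross G C x in let a := size (nb_out G C x) in
  let t := cut1 G C x in let D := 2 * t + n * n + a * a + 3 * (n + a) in
  0 < n ->
  n.+1 * ((t + n * n + 3 * n) * (t + n * n + 3 * n)) + n.+1 * (2 * (n + a) * n * D)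
    <= (n.+1 * (5 * t + 4 * cut2_out G C x + 3 * (n * n) + 3 * n)
        + 4 * n * cut2_in G C x) * D.
Proof.
move=> Cx n a t D n0.
set r := cut2_out G C x; set q := cut2_in G C x.
pose A : R := (5 * t%:R + 4 * r%:R + 4 * n%:R / n.+1%:R * q%:R
  + 3 * n%:R ^+ 2 + 3 * n%:R - 2 * (n + a)%:R * n%:R)%R.
have D0 : 0 < D by rewrite /D; lia.
have := @discriminant_le0 A (t%:R + n%:R ^+ 2 + 3 * n%:R)%R D%:R%R.
rewrite ltr0n => /(_ D0) H.
have {H} /H : forall s : R,
    (0 <= A - 2 * (t%:R + n%:R ^+ 2 + 3 * n%:R) * s + D%:R * s ^+ 2)%R.
  move=> s; have := two_value_ineq nb_size Cx s (CD0 x).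
  have := size_nb_in_out nb_size Cx; rewrite -/n -/a -/t -/r -/q => <-.
  move/le_trans; apply; rewrite le_eqVlt; apply/orP; left; apply/eqP.
  by rewrite /A /D !natrD !natrM; ring.
have n1 : (0 < n.+1%:R :> R)%R by rewrite ltr0n.
rewrite -(ler_pM2l n1) => H; rewrite -(ler_nat R) !(natrD, natrM).
move: H; rewrite [X in (_ <= X)%R]mulrA /A.
have -> : (n.+1%:R * (5 * t%:R + 4 * r%:R + 4 * n%:R / n.+1%:R * q%:R +
      3 * n%:R ^+ 2 + 3 * n%:R - 2 * (n + a)%:R * n%:R) =
  n.+1%:R * (5 * t%:R + 4 * r%:R + 3 * n%:R ^+ 2 + 3 * n%:R - 2 * (n + a)%:R * n%:R)
    + 4 * n%:R * q%:R :> R)%R by field; rewrite gt_eqF.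
rewrite /D !(natrD, natrM); lra.
Qed.

Lemma max_vertex_exceptional (C : pred V) x m : ~~ C x -> cut_le G C m ->
    m.+2 <= d -> (forall v, cross G C v <= cross G C x) ->
    0 < cross G C x -> 2 * cross G C x <= d ->
  [/\ cross G C x = 2, cut1 G C x = 2 & d = 6 \/ d = 7].
Proof.
move=> Cx Cm md maxx n0 n2; have nad := size_nb_in_out nb_size Cx.
have := cut_arithmetic erefl (two_value_nat Cx n0); rewrite nad; apply.
- by rewrite n0 -(leq_add2l (cross G C x)) nad addnn -mul2n.
- apply: leq_trans (cut_around G Cx) _.
  apply: (@leq_trans (\sum_(z <- nb_in G C x) cross G C x)).
    by apply: leq_sum => z _.
  by rewrite big_const_seq count_predT iter_addn_0 (size_nb_in G Cx).
- by apply: leq_trans md; rewrite addn2 !ltnS; exact: cut_count.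
Qed.

End MaximalVertex.

(** * The exceptional configuration *)

Section Exceptional.
Import GRing.Theory Num.Theory Order.TTheory.
Local Open Scope ring_scope.
Variables (R : realType) (V : choiceType) (G : lfgraph V) (d : nat).
Hypothesis nb_size : forall x, size (nb G x) = d.
Variables (C : pred V) (x y1 y2 u : V).
(** The cut contains the cycle [x], [y1], [u], [y2], and [x] and [u] are
    adjacent.  By [nb_inE], [cross_y] and [cross_u], no other edge of the cut is
    incident with a vertex of the cycle. *)
Hypotheses (Cx : ~~ C x) (nb_inE : nb_in G C x = [:: y1; y2]).
Hypotheses (xu : G x u) (Cu : ~~ C u) (y1u : G y1 u) (y2u : G y2 u).
Hypothesis cross_y : forall y w, y \in [:: y1; y2] -> G y w -> ~~ C w ->
  w = x \/ w = u.
Hypothesis cross_u : forall w, G u w -> C w -> w \in [:: y1; y2].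

Let O' := [seq z <- nb_out G C x | z != u].
Let Si := sphere2_in G C x.
Let So := sphere2_out G C x.
Let degO z := count (mem O') (nb G z).
Let degu z := count (mem [:: u]) (nb G z).

(** The value at [u] lies between the values at [y1] and [y2] and at the other
    neighbours of [x], because [u] is adjacent to vertices of both kinds. *)
Definition three_value_test v : R :=
  if v == x then 0 else
  if G x v then (if C v then 5 else if v == u then 1 else - 2) else
  if C v then (if deg_out G C x v == 0%N then 10 else 3) else - 4.

Let f := three_value_test.

Let mem_O' z : (z \in O') = [&& z != u, ~~ C z & G x z].
Proof. by rewrite mem_filter mem_nb_out. Qed.

Let uniq_O' : uniq O'. Proof. by rewrite filter_uniq ?nb_out_uniq. Qed.

Let mem_y y : (y \in [:: y1; y2]) = C y && G x y.
Proof. by rewrite -nb_inE mem_nb_in. Qed.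

Let xN v : G x v -> v == x = false.
Proof. by case: eqVneq => // ->; rewrite adj_irrefl. Qed.

Let f_in y : C y && G x y -> f y = 5.
Proof. by case/andP=> Cy xy; rewrite /f /three_value_test xN // xy Cy. Qed.

Let f_u : f u = 1.
Proof. by rewrite /f /three_value_test xN // xu (negbTE Cu) eqxx. Qed.

Let f_O' y : y \in O' -> f y = - 2.
Proof.
rewrite mem_O' => /and3P[yu Cy xy].
by rewrite /f /three_value_test xN // xy (negbTE Cy) (negbTE yu).
Qed.

Let sum_count A (p : pred V) (c : R) : \sum_(y <- A | p y) c = (count p A)%:R * c.
Proof. by rewrite big_const_seq iter_addr_0 -[LHS]mulr_natl. Qed.

Let energyE z : sphere_energy G x f z =
  (deg_in G C x z)%:R * (f z - 10) ^+ 2 + (degu z)%:R * (f z - 2) ^+ 2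
    + (degO z)%:R * (f z + 4) ^+ 2.
Proof.
rewrite /sphere_energy (bigID C) /= -addrA -!sum_count; congr (_ + _).
  rewrite (eq_bigl (mem (nb_in G C x))) => [|y]; last by rewrite inE mem_nb_in andbC.
  apply: eq_bigr => y; rewrite inE mem_nb_in => /f_in ->.
  by congr (_ ^+ 2); ring.
rewrite (bigID (pred1 u)) /=; congr (_ + _).
  rewrite (eq_bigl (mem [:: u])) => [|y]; last first.
    by rewrite inE mem_seq1; case: eqVneq => [->|]; rewrite ?andbF // xu Cu.
  apply: eq_bigr => y; rewrite inE mem_seq1 => /eqP->; rewrite f_u.
  by congr (_ ^+ 2); ring.
rewrite (eq_bigl (mem O')) => [|y]; last first.
  by rewrite inE mem_O'; case: (y != u); rewrite ?andbF ?andbT // andbC.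
by apply: eq_bigr => y /f_O' ->; congr (_ ^+ 2); ring.
Qed.

Let deg_in0 z : ~~ C z -> z != x -> z != u -> deg_in G C x z = 0%N.
Proof.
move=> Cz zx zu; apply/eqP; rewrite -leqn0 leqNgt -has_count; apply/hasPn => y yz.
apply/negP => /=; rewrite nb_inE => yY.
have {}yz : G y z by rewrite adj_sym -mem_nb.
by case: (cross_y yY yz Cz) => e; [move: zx|move: zu]; rewrite e eqxx.
Qed.

Let degO_le z : (degO z <= deg_out G C x z)%N.
Proof. by apply: sub_count => v /=; rewrite mem_filter => /andP[]. Qed.

Let size_O' : (size O' + 3 = d)%N.
Proof.
have := size_nb_in_out nb_size Cx; rewrite -(size_nb_in G Cx) nb_inE /= => <-.
rewrite /O' size_filter -(count_predC (pred1 u) (nb_out G C x)).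
rewrite count_uniq_mem ?nb_out_uniq // mem_nb_out Cu xu.
by rewrite -[count (fun z => _) _]/(count (predC (pred1 u)) _) /=; lia.
Qed.

(** The neighbours of [u]: besides [x], [y1] and [y2] they are either
    neighbours of [x] or at distance two from [x], on the side of [x]. *)
Let degree_u : (count (G u) O' + count (G u) So + 3 <= d)%N.
Proof.
rewrite -(nb_size u) -!size_filter -size_cat addn3.
have sub : {subset x :: [:: y1, y2 & [seq z <- O' | G u z]
    ++ [seq z <- So | G u z]] <= nb G u}.
  move=> z; rewrite [z \in nb G u]mem_nb !inE mem_cat.
  case/or4P => [/eqP->|/eqP->|/eqP->|/orP[]]; try by rewrite adj_sym.
    by rewrite mem_filter => /andP[].
  by rewrite mem_filter => /andP[].
apply: (uniq_leq_size _ sub).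
have uY : uniq (x :: nb_in G C x).
  by rewrite /= nb_in_uniq mem_nb_in (negbTE Cx).
rewrite -[x :: _]/([:: x; y1; y2] ++ _) cat_uniq -nb_inE uY /=.
have dis z : (z \in [seq z <- O' | G u z]) || (z \in [seq z <- So | G u z]) ->
    z != x /\ ~~ C z.
  case/orP; rewrite mem_filter => /andP[_].
    by rewrite mem_O' => /and3P[_ -> /xN->].
  by rewrite mem_filter mem_sphere2 => /andP[-> /andP[->]].
apply/andP; split.
  apply/hasPn => z; rewrite mem_cat => /dis[zx Cz].
  by rewrite inE (negbTE zx) mem_nb_in (negbTE Cz).
rewrite cat_uniq; apply/and3P; split; rewrite ?filter_uniq ?undup_uniq ?nb_uniq //.
apply/hasPn => z; rewrite mem_filter => /andP[_].
rewrite mem_filter mem_sphere2 => /andP[_ /and3P[_ xz _]] /=.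
by rewrite mem_filter mem_O' (negbTE xz) !andbF.
Qed.

Let sum_degu A : uniq A -> (\sum_(z <- A) degu z = count (G u) A)%N.
Proof.
move=> uA; rewrite -sum1_count [RHS]big_mkcond; apply: eq_bigr => z _.
rewrite /degu (eq_count (a2 := pred1 u)) => [|v]; last by rewrite /= mem_seq1.
by rewrite count_uniq_mem ?nb_uniq // mem_nb adj_sym; case: (G u z).
Qed.

Let degO_u : degO u = count (G u) O'.
Proof.
have := @edge_double_count V G [:: u] O' isT uniq_O'.
by rewrite big_seq1 -/(degO u) => ->; rewrite -sum_degu.
Qed.

Let size_nbY : (size (nb_in G C x) = 2)%N. Proof. by rewrite nb_inE. Qed.

Let energy_in : \sum_(z <- nb_in G C x) sphere_energy G x f z <= 68.
Proof.
have -> : 68 = \sum_(z <- nb_in G C x) 34 :> R.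
  by rewrite (sum_count _ xpredT) count_predT size_nbY; ring.
rewrite big_seq [leRHS]big_seq; apply: ler_sum => z zY.
rewrite energyE f_in -?mem_nb_in //.
have -> : degO z = 0%N.
  apply/eqP; rewrite -leqn0 leqNgt -has_count; apply/hasPn => w wz /=.
  rewrite mem_O'; apply/negP => /and3P[wu Cw xw].
  rewrite nb_inE in zY; rewrite mem_nb in wz.
  case: (cross_y zY wz Cw) => e; last by rewrite e eqxx in wu.
  by move/xN: xw; rewrite e eqxx.
have p1 : (deg_in G C x z)%:R <= 1 :> R.
  by have := deg_in_lt Cx zY; rewrite -(size_nb_in G Cx) size_nbY lern1; lia.
have e1 : (degu z)%:R <= 1 :> R.
  rewrite lern1 /degu (eq_count (a2 := pred1 u)) => [|v]; last by rewrite /= mem_seq1.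
  by rewrite count_uniq_mem ?nb_uniq //; case: (_ \in _).
lra.
Qed.

Let energy_u : sphere_energy G x f u <= 162 + 25 * (count (G u) O')%:R.
Proof.
rewrite energyE f_u degO_u.
have -> : degu u = 0%N.
  apply/eqP; rewrite -leqn0 leqNgt -has_count; apply/hasPn => w.
  by rewrite mem_nb /= mem_seq1; case: eqVneq => // ->; rewrite adj_irrefl.
have : (deg_in G C x u)%:R <= 2 :> R.
  by rewrite ler_nat -size_nbY (size_nb_in G Cx) deg_in_le.
lra.
Qed.

Let energy_O' : \sum_(z <- O') sphere_energy G x f z <=
  16 * (count (G u) O')%:R + 4 * (size O')%:R * ((size O')%:R - 1).
Proof.
rewrite -sum_degu // natr_sum mulr_sumr mulrAC -[X in _ + X]mulrC.
have -> : (size O')%:R * (4 * ((size O')%:R - 1)) =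
    \sum_(z <- O') 4 * ((size O')%:R - 1) :> R.
  by rewrite (sum_count _ xpredT) count_predT.
rewrite -big_split /= big_seq [leRHS]big_seq; apply: ler_sum => z zO.
rewrite energyE f_O' //; move: (zO); rewrite mem_O' => /and3P[zu Cz /xN zx].
rewrite deg_in0 ?zx //.
have : (degO z)%:R + 1 <= (size O')%:R :> R.
  rewrite natr1 ler_nat /degO -size_filter.
  have sub : {subset z :: [seq y <- nb G z | y \in O'] <= O'}.
    by move=> y; rewrite inE mem_filter => /predU1P[->|/andP[]].
  apply: (uniq_leq_size _ sub) => /=.
  by rewrite mem_filter mem_nb adj_irrefl andbF filter_uniq ?nb_uniq.
lra.
Qed.

Let energy_So : \sum_(z <- So) sphere_energy G x f z <= 36 * (count (G u) So)%:R.
Proof.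
rewrite -sum_degu ?sphere2_out_uniq // natr_sum mulr_sumr.
rewrite big_seq [leRHS]big_seq; apply: ler_sum => z.
rewrite mem_filter mem_sphere2 => /andP[Cz /and3P[zx xz _]].
rewrite energyE deg_in0 //; last by apply: contraNneq xz => ->.
rewrite /f /three_value_test (negbTE zx) (negbTE xz) (negbTE Cz).
lra.
Qed.

Let energy_Si : \sum_(z <- Si) sphere_energy G x f z <=
  147 * (cut2_in G C x)%:R.
Proof.
rewrite /cut2_in natr_sum mulr_sumr.
rewrite big_seq [leRHS]big_seq; apply: ler_sum => z.
rewrite mem_filter mem_sphere2 => /andP[Cz /and3P[zx xz _]].
rewrite energyE /f /three_value_test (negbTE zx) (negbTE xz) Cz.
have -> : degu z = 0%N.
  apply/eqP; rewrite -leqn0 leqNgt -has_count; apply/hasPn => w.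
  rewrite mem_nb /= mem_seq1 => zw; apply/eqP => wu.
  have : z \in [:: y1; y2] by apply: cross_u; rewrite // adj_sym -wu.
  by rewrite mem_y (negbTE xz) andbF.
have oz := degO_le z.
have pz : (deg_in G C x z <= 2)%N by rewrite -size_nbY (size_nb_in G Cx) deg_in_le.
move: (deg_in G C x z) (degO z) (deg_out G C x z) oz pz => p o k.
case: ifPn => [/eqP->|k0] oz pz.
  by move: oz; rewrite leqn0 => /eqP->; lra.
have : (p + o <= 3 * k)%N by clear -oz pz k0; lia.
by rewrite -(ler_nat R) natrD natrM; lra.
Qed.

(** The right-hand side is negative for [d = 6] without, and for [d = 7] with at
    most one, further edge of the cut. *)
Lemma three_value_ineq (D : R) : D = d%:R -> CD_infty G (0 : R) x ->
  0 <= 230 + 41 * (D - 3) + 4 * (D - 3) * (D - 4) + 147 * (cut2_in G C x)%:R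
     - (2 * D - 4) * (51 + 4 * (D - 3)) + 2 * (11 - 2 * (D - 3)) ^+ 2.
Proof.
move=> DE CD; have fx : f x = 0 by rewrite /f /three_value_test eqxx.
have := CD0_spheres nb_size CD fx; rewrite !(sum_nb_split G C x).
have uO : u \in nb_out G C x by rewrite mem_nb_out Cu xu.
rewrite !(bigD1_seq u uO (nb_out_uniq G C x)) /=.
rewrite -!(big_filter (nb_out G C x)) -/O'.
rewrite [X in _ + X - _](bigID C) /=.
rewrite -[\sum_(z <- sphere2 G x | C z) _]big_filter.
rewrite -[\sum_(z <- sphere2 G x | ~~ C z) _]big_filter.
rewrite -/(sphere2_in G C x) -/(sphere2_out G C x) -/Si -/So f_u.
have in_const (F : V -> R) c : (forall y, C y && G x y -> F y = c) ->
    \sum_(y <- nb_in G C x) F y = 2 * c.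
  move=> Fc; rewrite big_seq (eq_bigr (fun=> c)) => [|y]; last first.
    by rewrite mem_nb_in => /Fc.
  by rewrite -big_seq (sum_count _ xpredT) count_predT size_nbY.
have O'_const (F : V -> R) c : (forall y, y \in O' -> F y = c) ->
    \sum_(y <- O') F y = (D - 3) * c.
  move=> Fc; rewrite big_seq (eq_bigr (fun=> c)) => [|y]; last exact: Fc.
  rewrite -big_seq (sum_count _ xpredT) count_predT DE -size_O' natrD; ring.
rewrite (in_const (fun y => f y ^+ 2) (5 ^+ 2)) => [|y yY]; last by rewrite f_in.
rewrite (in_const f 5) => [|y yY]; last by rewrite f_in.
rewrite (O'_const (fun y => f y ^+ 2) ((-2) ^+ 2)) => [|y yY]; last by rewrite f_O'.
rewrite (O'_const f (-2)) => [|y yY]; last by rewrite f_O'.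
have := energy_in; have := energy_u; have := energy_O'; have := energy_So.
have := energy_Si.
set e1 := \sum_(z <- nb_in G C x) _; set e2 := \sum_(z <- O') _.
set e3 := \sum_(z <- Si) _; set e4 := \sum_(z <- So) _.
have -> : (size O')%:R = D - 3 by rewrite DE -size_O' natrD; ring.
have : (count (G u) O')%:R + (count (G u) So)%:R <= D - 3.
  by rewrite lerBrDr DE -!natrD ler_nat degree_u.
set al := (count _ O')%:R; set be := (count _ So)%:R.
have : 0 <= be by [].
rewrite -DE; lra.
Qed.

End Exceptional.

(** * Edge connectivity *)

Section EdgeConnectivity.
Import GRing.Theory Num.Theory Order.TTheory.
Variables (R : realType) (V : choiceType) (G : lfgraph V) (d : nat).
Hypothesis nb_size : forall x, size (nb G x) = d.
Hypothesis CD0 : forall x, CD_infty G (0%R : R) x.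

(** Each neighbour [y] of [x] across the cut has exactly two neighbours across
    the cut: [x] and a neighbour [u] of [x]. *)
Lemma exceptional_structure (C : pred V) x m : ~~ C x -> cut_le G C m ->
    m.+2 <= d -> (forall v, cross G C v <= 2) -> cross G C x = 2 ->
  [/\ d = 6 \/ d = 7, size (nb_in G C x) = 2 &
      forall y, G x y -> C y -> cross G C y = 2 /\
        exists u, [/\ ~~ C u, G x u, G y u &
          forall w, G y w -> ~~ C w -> w = x \/ w = u]].
Proof.
move=> Cx Cm md cross2 crossx.
have [|||_ t2 d67] := max_vertex_exceptional nb_size CD0 Cx Cm md.
- by move=> v; rewrite crossx.
- by rewrite crossx.
- (* The first sphere alone contains two edges of the cut, so that [4 <= d]. *)
  rewrite crossx; apply: leq_trans md.
  have := Cm _ (nb_in_uniq G C x); rewrite -big_filter.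
  have -> : [seq v <- nb_in G C x | C v] = nb_in G C x.
    by apply/all_filterP/allP => v; rewrite mem_nb_in => /andP[].
  have := cut_around G Cx; rewrite crossx; lia.
have sz2 := size_nb_in G Cx; rewrite crossx in sz2; split=> // y xy Cy.
have yY : y \in nb_in G C x by rewrite mem_nb_in Cy.
have cross_in z : z \in nb_in G C x -> 1 + deg_out G C x z <= cross G C z.
  by move/(cross_nb_in Cx); apply: leq_trans; apply: leq_addr.
(* Two neighbours across the cut, with [cut1 = 2] and cross-degree at most two,
   must have exactly one further cut edge each, inside the first sphere. *)
have dy : deg_out G C x y = 1.
  move: t2 (yY) cross_in; rewrite /cut1; case: (nb_in G C x) sz2 => [|a [|b []]] //= _.
  rewrite big_cons big_seq1 => dab yab cin.
  have := cin a; have := cin b; rewrite !inE !eqxx orbT => /(_ isT) hb /(_ isT) ha.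
  have := cross2 a; have := cross2 b => hb' ha'.
  by move: yab; rewrite !inE => /orP[]/eqP->; clear -dab hb ha hb' ha'; lia.
have cy : cross G C y = 2.
  by apply/eqP; rewrite eqn_leq cross2; apply: leq_trans (cross_in y yY); rewrite dy.
split=> //.
have /hasP[u uy uO] : has (mem (nb_out G C x)) (nb G y).
  by rewrite has_count -/(deg_out G C x y) dy.
move: uO; rewrite /= mem_nb_out => /andP[Cu xu]; rewrite mem_nb in uy.
exists u; split=> // w yw Cw.
have := cy; rewrite /cross -size_filter => sz.
have inF v : G y v -> ~~ C v -> v \in [seq u <- nb G y | C u != C y].
  by move=> yv Cv; rewrite mem_filter mem_nb yv Cy (negbTE Cv).
apply: contraPP sz => /not_orP[wx wu] sz.
have sub : {subset [:: w; x; u] <= [seq u <- nb G y | C u != C y]}.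
  move=> v; rewrite !inE => /or3P[]/eqP->; apply: inF => //.
  by rewrite adj_sym.
have uL : uniq [:: w; x; u].
  rewrite /= !inE andbT negb_or; apply/andP; split.
    by apply/andP; split; apply/eqP.
  by apply: contraTneq xu => ->; rewrite adj_irrefl.
by have := uniq_leq_size uL sub; rewrite sz.
Qed.

(** The structure found at [x] is also that found at [y1] and [y2], which closes
    the cycle of length four. *)
Lemma no_exception (C : pred V) x m : ~~ C x -> cut_le G C m ->
  m.+2 <= d -> (forall v, cross G C v <= 2) -> cross G C x <> 2.
Proof.
move=> Cx Cm md cross2 crossx.
have [d67 sz2 str] := exceptional_structure Cx Cm md cross2 crossx.
have m5 : m <= 5 by case: d67 md => ->; lia.
case nbE : (nb_in G C x) sz2 => [|y1 [|y2 []]] //= _.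
have memY y : (y \in [:: y1; y2]) = C y && G x y by rewrite -nbE mem_nb_in.
have uY : uniq [:: y1; y2] by rewrite -nbE nb_in_uniq.
have /andP[Cy1 xy1] : C y1 && G x y1 by rewrite -memY mem_head.
have /andP[Cy2 xy2] : C y2 && G x y2 by rewrite -memY !inE eqxx orbT.
have [cy1 [u1 [Cu1 xu1 y1u1 ny1]]] := str y1 xy1 Cy1.
have [cy2 [u2 [Cu2 xu2 y2u2 ny2]]] := str y2 xy2 Cy2.
have Cm' := cut_le_predC Cm.
have cross2' v : cross G (predC C) v <= 2 by rewrite cross_predC.
have str' y : C y -> cross G C y = 2 -> forall v, G y v -> ~~ C v ->
    cross G C v = 2 /\ exists w, [/\ C w, G y w, G v w &
      forall w', G v w' -> C w' -> w' = y \/ w' = w].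
  move=> Cy cy v yv Cv; have Cy' : ~~ predC C y by rewrite /= Cy.
  have cy' : cross G (predC C) y = 2 by rewrite cross_predC.
  have [_ _ /(_ v yv Cv)] := exceptional_structure Cy' Cm' md cross2' cy'.
  rewrite cross_predC => -[-> [w [/= /negPn Cw yw vw nw]]]; split=> //.
  by exists w; split=> // w' vw' Cw'; apply: nw => //; rewrite /= Cw'.
have [cu1 [w1 [Cw1 y1w1 u1w1 nu1]]] := str' y1 Cy1 cy1 u1 y1u1 Cu1.
have [cu2 _] := str' y2 Cy2 cy2 u2 y2u2 Cu2.
have [u12|u12] := eqVneq u1 u2; last first.
  (* Otherwise [x], [u1] and [u2] are incident with six edges of the cut. *)
  have uL : uniq [:: x; u1; u2].
    rewrite /= !inE negb_or u12 !andbT; apply/andP; split.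
      by apply: contraTneq xu1 => <-; rewrite adj_irrefl.
    by apply: contraTneq xu2 => <-; rewrite adj_irrefl.
  have := Cm' _ uL; rewrite !big_cons big_nil /= Cx Cu1 Cu2.
  by rewrite !cross_predC crossx cu1 cu2 leqNgt ltnS m5.
rewrite -{}u12 {u2 cu2 Cu2 xu2} in y2u2 ny2.
have cross_y y w : y \in [:: y1; y2] -> G y w -> ~~ C w -> w = x \/ w = u1.
  by rewrite !inE => /orP[]/eqP->; [apply: ny1|apply: ny2].
have cross_u w : G u1 w -> C w -> w \in [:: y1; y2].
  have y12 : y2 = w1.
    have : y2 = y1 \/ y2 = w1 by apply: nu1; rewrite // adj_sym.
    by case=> // e; move: uY; rewrite e /= inE eqxx.
  by move=> u1w Cw; rewrite !inE y12; case: (nu1 w u1w Cw) => ->; rewrite eqxx ?orbT.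
have q_le : 4 + cut2_in G C x <= m.
  have t2 : cut1 G C x = 2.
    have [|||//] := max_vertex_exceptional nb_size CD0 Cx Cm md.
    - by move=> v; rewrite crossx.
    - by rewrite crossx.
    - by rewrite crossx; case: d67 => ->.
  have := cut_count Cx Cm; rewrite t2 crossx; clear; lia.
have := three_value_ineq nb_size Cx nbE xu1 Cu1 y1u1 y2u2 cross_y cross_u erefl (CD0 x).
case: d67 => dE; rewrite dE in md *.
  have -> : cut2_in G C x = 0 by clear -md q_le; lia.
  by rewrite leNgt => /negP; apply; lra.
have : cut2_in G C x <= 1 by clear -md q_le; lia.
rewrite -(ler_nat R); set q := (cut2_in _ _ _)%:R%R => q1.
by rewrite leNgt => /negP; apply; lra.
Qed.

Lemma leq_sum_subset (F : V -> nat) (A B : seq V) : uniq A -> uniq B ->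
  {subset A <= B} -> \sum_(z <- A) F z <= \sum_(z <- B) F z.
Proof.
move=> uA uB AB; rewrite [leqRHS](bigID (mem A)) /= -[X in _ <= X + _]big_filter.
have pA : perm_eq A [seq z <- B | z \in A].
  apply: uniq_perm; rewrite ?filter_uniq // => z; rewrite mem_filter.
  by case: (boolP (z \in A)) => // /AB ->.
by rewrite -(perm_big _ pA) leq_addr.
Qed.

(** Moving [v] into [C] replaces its edges to [C] by its edges to the
    complement. *)
Lemma cut_le_add (C : pred V) v m : ~~ C v -> cut_le G C m ->
  cut_le G (predU1 v C) (m - cross G C v + (d - cross G C v)).
Proof.
move=> Cv Cm W uW; set C' : pred V := predU1 v C; set n := cross G C v.
pose W2 := undup (nb_in G C v ++ [seq z <- W | C z]).
have W2C z : z \in W2 -> C z.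
  by rewrite mem_undup mem_cat mem_nb_in mem_filter => /orP[]/andP[].
apply: (@leq_trans (cross G C' v + \sum_(z <- W2) cross G C' z)).
  rewrite -big_filter -(big_cons _ _ v W2 xpredT); apply: leq_sum_subset.
  - exact: filter_uniq.
  - by rewrite /= undup_uniq andbT; apply: contra Cv => /W2C.
  move=> z; rewrite mem_filter => /andP[/predU1P[->|Cz] zW]; first exact: mem_head.
  by rewrite inE mem_undup mem_cat !mem_filter Cz zW !orbT.
rewrite addnC; apply: leq_add.
  rewrite leq_subRL; last first.
    by apply: leq_trans (cut_count Cv Cm); rewrite -!addnA leq_addr.
  apply: leq_trans (Cm W2 (undup_uniq _)).
  have -> : \sum_(z <- W2 | C z) cross G C z = \sum_(z <- W2) cross G C z.
    rewrite big_seq_cond [RHS]big_seq; apply: eq_bigl => z.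
    by case: (boolP (z \in W2)) => // /W2C ->.
  apply: (@leq_trans (\sum_(z <- W2) (count (pred1 v) (nb G z) + cross G C' z))).
    rewrite big_split leq_add2r /=.
    rewrite /n -(size_nb_in G Cv) -sum1_size.
    apply: (@leq_trans (\sum_(z <- nb_in G C v) count (pred1 v) (nb G z))).
      rewrite big_seq [leqRHS]big_seq; apply: leq_sum => z.
      rewrite mem_nb_in => /andP[_ vz].
      by rewrite count_uniq_mem ?nb_uniq // mem_nb adj_sym vz.
    apply: leq_sum_subset; rewrite ?nb_in_uniq ?undup_uniq // => z zv.
    by rewrite mem_undup mem_cat zv.
  rewrite big_seq [leqRHS]big_seq; apply: leq_sum => z /W2C Cz.
  rewrite /cross !count_sum -big_split /=; apply: leq_sum => u _.
  rewrite Cz /C' /= Cz orbT; case: eqVneq => [->|_]; last by case: (C u).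
  by rewrite (negbTE Cv).
rewrite leq_subRL; last by rewrite -(nb_size v) count_size.
rewrite -(nb_size v) -sum1_size /n /cross !count_sum -big_split /=.
apply: leq_sum => u _; rewrite /C' /= (negbTE Cv) eqxx /=.
by case: (eqVneq u v) => [->|_]; [rewrite (negbTE Cv)|case: (C u)].
Qed.

(** In a smallest cut with fewer than [d - 1] edges, no vertex has more than half
    of its neighbours across. *)
Lemma cross_le_half (C : pred V) u v m :
    (forall k (C' : pred V) u' v', k < m -> C' u' -> ~~ C' v' -> cut_le G C' k ->
      d <= k.+1) ->
    m.+2 <= d -> C u -> ~~ C v -> cut_le G C m -> 2 * cross G C v <= d.
Proof.
move=> IH md Cu Cv Cm; rewrite leqNgt; apply/negP => lt.
have nm : cross G C v <= m.
  by apply: leq_trans (cut_count Cv Cm); rewrite -!addnA leq_addr.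
have Cm' := cut_le_add Cv Cm.
have [w Cw] : exists w, ~~ predU1 v C w.
  apply: contrapT => /forallNP allC.
  have : cross G C v = d.
    rewrite -(nb_size v) /cross -(count_predT (nb G v)).
    apply: eq_in_count => w; rewrite mem_nb /= => vw.
    have := allC w; rewrite /= (negbTE Cv); case: eqVneq vw => [->|_ _].
      by rewrite adj_irrefl.
    by case: (C w).
  by clear -md nm; lia.
have := IH _ _ u w _ _ Cw Cm'; rewrite /= Cu orbT; clear -lt nm md => IH.
have lt' : m - cross G C v + (d - cross G C v) < m by lia.
by have := IH lt' isT; lia.
Qed.

(** Every cut has at least [d - 1] edges. *)
Theorem edge_connectivity m (C : pred V) u v : connected_graph G ->
  C u -> ~~ C v -> cut_le G C m -> d <= m.+1.
Proof.
move=> conn; elim/ltn_ind: m C u v => m IH C u v Cu Cv Cm.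
rewrite leqNgt; apply/negP => md.
have half w : 2 * cross G C w <= d.
  have [Cw|Cw] := boolP (C w); last first.
    by apply: cross_le_half md Cu Cw Cm => k C' u' v' km; apply: IH.
  have Cw' : ~~ predC C w by rewrite /= Cw.
  rewrite -cross_predC.
  apply: cross_le_half md (Cv : predC C v) Cw' (cut_le_predC Cm) => k C' u' v' km.
  exact: IH.
pose P k := `[< exists w, cross G C w = k >].
have [x0 x0_gt0] := cross_exists conn Cu Cv.
have exP : exists k, P k by exists (cross G C x0); apply/asboolP; exists x0.
have boundP k : P k -> k <= d.
  by move=> /asboolP[w <-]; rewrite -(nb_size w) count_size.
case: (ex_maxnP exP boundP) => n /asboolP[x xn] maxn.
have maxx w : cross G C w <= cross G C x.
  by rewrite xn; apply: maxn; apply/asboolP; exists w.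
have x_gt0 : 0 < cross G C x by apply: leq_trans x0_gt0 (maxx x0).
suff key (D : pred V) : ~~ D x -> cut_le G D m ->
    (forall w, cross G D w = cross G C w) -> False.
  have [Cx|Cx] := boolP (C x); last exact: (key C Cx Cm).
  apply: (key (predC C)); [by rewrite /= Cx|exact: cut_le_predC|].
  by move=> w; rewrite cross_predC.
move=> Dx Dm DC.
have [|||x2 _ _] := max_vertex_exceptional nb_size CD0 Dx Dm md.
- by move=> w; rewrite !DC.
- by rewrite DC.
- by rewrite DC.
apply: (no_exception Dx Dm md _ x2) => w.
by rewrite DC -x2 DC.
Qed.

Lemma even_handshake (L : seq V) : uniq L ->
  ~~ odd (\sum_(v <- L) count (mem L) (nb G v)).
Proof.
elim: L => [|v L IH] /=; first by rewrite big_nil.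
case/andP=> vL uL; rewrite big_cons.
have step w : count (mem (v :: L)) (nb G w) =
    count (mem [:: v]) (nb G w) + count (mem L) (nb G w).
  rewrite !count_sum -big_split; apply: eq_bigr => z _ /=; rewrite inE mem_seq1.
  by case: eqVneq => [->|//]; rewrite (negbTE vL).
have -> : count (mem (v :: L)) (nb G v) = count (mem L) (nb G v).
  rewrite step (_ : count (mem [:: v]) _ = 0) //.
  apply/eqP; rewrite -leqn0 leqNgt -has_count; apply/hasPn => w.
  by rewrite mem_nb /= mem_seq1; case: eqVneq => // ->; rewrite adj_irrefl.
rewrite (eq_bigr _ (fun w _ => step w)) big_split /=.
have := @edge_double_count V G [:: v] L isT uL; rewrite big_seq1 => ->.
by rewrite addnA addnn oddD odd_double addFb; apply: IH.
Qed.

(** The number of edges leaving [L] has the parity of [d * size L], which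
    excludes [d - 1]. *)
Lemma odd_cut (L : seq V) : connected_graph G -> even_or_infinite V ->
    uniq L -> odd (size L) ->
  d <= \sum_(v <- L) count [pred u | u \notin L] (nb G v).
Proof.
move=> conn evV uL oL; set m := \sum_(v <- L) _.
have Lm : cut_le G (mem L) m.
  move=> W uW; rewrite -big_filter.
  apply: leq_trans (_ : \sum_(z <- L) cross G (mem L) z <= m).
    apply: leq_sum_subset => //; first exact: filter_uniq.
    by move=> z; rewrite mem_filter => /andP[].
  rewrite /m big_seq [leqRHS]big_seq; apply: leq_sum => z zL.
  by apply: sub_count => w /=; rewrite zL; case: (w \in L).
have [u uL'] : exists u, u \in L.
  by case: (L) oL => // u L' _; exists u; apply: mem_head.
have [W [uW LW evW]] := even_superset L evV.
have [v vW vL] : exists2 v, v \in W & v \notin L.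
  apply/hasP; rewrite has_predC; apply: contra evW => /allP WL.
  suff -> : size W = size L by [].
  by apply/perm_size/uniq_perm => // z; apply/idP/idP; [apply: WL|apply: LW].
have := edge_connectivity conn (uL' : mem L u) vL Lm.
rewrite leq_eqVlt ltnS => /orP[/eqP dm|//].
have : \sum_(v <- L) size (nb G v) = \sum_(v <- L) count (mem L) (nb G v) + m.
  rewrite /m -big_split; apply: eq_bigr => z _ /=.
  by rewrite -(count_predC (mem L)).
rewrite (eq_bigr _ (fun z _ => nb_size z)) big_const_seq count_predT iter_addn_0 dm.
move/(congr1 odd); rewrite oddM oL andbT oddD (negbTE (even_handshake uL)) /=.
by case: (odd m).
Qed.

End EdgeConnectivity.

(** * Perfect matchings *)

Theorem theorem1p1 (R : realType) (V : choiceType) (G : lfgraph V)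
    (Gconnected : connected_graph G) (Gregular : regular_graph G)
    (Veven : even_or_infinite V) (Gcurv : (0 <= BE_curvature R G)%E) :
  exists M : set (set V), perfect_matching G M.
Proof.
have [d nb_size] := regular_size_nb Gregular.
suff [m mP] : exists m : V -> V, forall v, G v (m v) /\ m (m v) = v.
  exact: perfect_matching_of_involution mP.
have CD0 x : CD_infty G (0%R : R) x by apply: CD0_of_curvature_ge0.
have [d0|d_gt0] := posnP d; last first.
  apply: matching_compactness => F; apply: (finite_matching d_gt0 nb_size _ F Veven).
  by move=> L uL oL; apply: (odd_cut nb_size CD0).
(* A connected graph without edges has at most one vertex. *)
exists id => v; exfalso.
have allv w : w = v.
  have [[|u p] /=] := Gconnected v w; first by move=> _ ->.
  by rewrite -mem_nb (size0nil (etrans (nb_size v) d0)).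
have [W [uW sW]] := even_superset [:: v] Veven.
have vW : v \in W by apply: sW; apply: mem_head.
suff -> : size W = 1 by [].
apply/eqP; rewrite eqn_leq; apply/andP; split.
  by apply: (@uniq_leq_size _ W [:: v]) => // w _; rewrite mem_seq1 (allv w).
by case: (W) vW.
Qed.
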